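(* There exists a fusion category $\mathcal{B}$ such that $\mathcal{K}_0(\mathcal{B})=R'(0)$.
   Context: Fusion categories are over an algebraically closed field of characteristic $0$; $\mathcal{K}_0(\mathcal{B})$ is the Grothendieck ring, and equality means isomorphism of fusion rings. $R'(0)$ denotes the rank-six fusion ring with basis $\{\mathbf{1},g,h,gh,X,X^*\}$, where $\{\mathbf{1},g,h,gh\}\cong\mathbb{Z}/2\mathbb{Z}\times\mathbb{Z}/2\mathbb{Z}$, $X^*$ is the dual of $X$ and is distinct from $X$, and $g^2=h^2=\mathbf{1}$, $gX=X^*=Xg$, $XX^*=\mathbf{1}+h=X^*X$. *)

(* Defs.v *)
From HB Require Import structures.
From mathcomp Require Import all_boot all_order all_algebra.
From mathcomp Require Import boolp.

Set Implicit Arguments.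
Unset Strict Implicit.
Unset Printing Implicit Defensive.

Import GRing.Theory.
Local Open Scope ring_scope.

(* The morphism spaces are finite-dimensional because [vectType k] is the
   library's type of finite-dimensional vector spaces. *)
Record linCategory (k : fieldType) := LinCategory {
  ob :> Type;
  hom : ob -> ob -> vectType k;
  idm : forall X : ob, hom X X;
  comp : forall X Y Z : ob, hom Y Z -> hom X Y -> hom X Z;
  compA : forall (W X Y Z : ob) (h : hom Y Z) (g : hom X Y) (f : hom W X),
    comp h (comp g f) = comp (comp h g) f;
  comp1m : forall (X Y : ob) (f : hom X Y), comp (idm Y) f = f;
  compm1 : forall (X Y : ob) (f : hom X Y), comp f (idm X) = f;
  comp_linearl : forall (X Y Z : ob) (a : k) (g g' : hom Y Z) (f : hom X Y),
    comp (a *: g + g') f = a *: comp g f + comp g' f;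
  comp_linearr : forall (X Y Z : ob) (a : k) (g : hom Y Z) (f f' : hom X Y),
    comp g (a *: f + f') = a *: comp g f + comp g f'
}.

Arguments hom {k} C X Y : rename.
Arguments idm {k} C X : rename.
Arguments comp {k C X Y Z} g f : rename.

Declare Scope cat_scope.
Delimit Scope cat_scope with cat.
Notation "g \oc f" := (comp g f) (at level 50, left associativity) : cat_scope.
Local Open Scope cat_scope.

Section AbelianSemisimple.
Variables (k : fieldType) (C : linCategory k).
Implicit Types X Y Z T : C.

Definition inverse_pair X Y (f : hom C X Y) (g : hom C Y X) : Prop :=
  g \oc f = idm C X /\ f \oc g = idm C Y.

Definition is_iso X Y (f : hom C X Y) : Prop := exists g, inverse_pair f g.

Definition isomorphic X Y : Prop := exists f : hom C X Y, is_iso f.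

Definition is_mono X Y (f : hom C X Y) : Prop :=
  forall T (u v : hom C T X), f \oc u = f \oc v -> u = v.

Definition is_epi X Y (f : hom C X Y) : Prop :=
  forall T (u v : hom C Y T), u \oc f = v \oc f -> u = v.

Definition is_zero_ob Z : Prop :=
  forall T, (forall f : hom C Z T, f = 0) /\ (forall f : hom C T Z, f = 0).

Definition is_direct_sum (m : nat) (s : 'I_m -> C) Y : Prop :=
  exists (i : forall t, hom C (s t) Y) (p : forall t, hom C Y (s t)),
    [/\ forall t, p t \oc i t = idm C (s t),
        forall t u, t != u -> p u \oc i t = 0
      & \sum_t (i t \oc p t) = idm C Y].

Definition is_kernel X Y (f : hom C X Y) K (i : hom C K X) : Prop :=
  f \oc i = 0 /\
  forall T (t : hom C T X), f \oc t = 0 -> exists! u : hom C T K, i \oc u = t.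

Definition is_cokernel X Y (f : hom C X Y) Q (q : hom C Y Q) : Prop :=
  q \oc f = 0 /\
  forall T (t : hom C Y T), t \oc f = 0 -> exists! u : hom C Q T, u \oc q = t.

Definition additive_category : Prop :=
  (exists Z, is_zero_ob Z) /\
  (forall X1 X2, exists Y,
     is_direct_sum (fun t : 'I_2 => if t == ord0 then X1 else X2) Y).

Definition abelian_category : Prop :=
  [/\ additive_category,
      forall X Y (f : hom C X Y), exists K (i : hom C K X), is_kernel f i,
      forall X Y (f : hom C X Y), exists Q (q : hom C Y Q), is_cokernel f q,
      forall X Y (i : hom C X Y), is_mono i ->
        exists Z (f : hom C Y Z), is_kernel f i
    & forall X Y (q : hom C X Y), is_epi q ->
        exists Z (f : hom C Z X), is_cokernel f q].

Definition simple_ob X : Prop :=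
  ~ is_zero_ob X /\
  forall Y (i : hom C Y X), is_mono i -> is_zero_ob Y \/ is_iso i.

Definition simple_decomposition Y (d : {m : nat & 'I_m -> C}) : Prop :=
  (forall t, simple_ob (projT2 d t)) /\ is_direct_sum (projT2 d) Y.

Definition semisimple_category : Prop :=
  abelian_category /\ forall Y, exists d, simple_decomposition Y d.

(* [r] lists every isomorphism class of simple objects exactly once. *)
Definition simple_representatives (r : {n : nat & 'I_n -> C}) : Prop :=
  [/\ forall i, simple_ob (projT2 r i),
      forall i j, isomorphic (projT2 r i) (projT2 r j) -> i = j
    & forall X, simple_ob X -> exists i, isomorphic X (projT2 r i)].

End AbelianSemisimple.

(* The tensor product is a bifunctor, bilinear on morphisms; the associator
   and the unitors are given together with their inverses. *)
Record monoidalCategory (k : fieldType) := MonoidalCategory {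
  underlying :> linCategory k;
  unitob : underlying;
  tens : underlying -> underlying -> underlying;
  tensm : forall X X' Y Y' : underlying,
    hom underlying X X' -> hom underlying Y Y' ->
    hom underlying (tens X Y) (tens X' Y');
  tensm1 : forall X Y : underlying,
    tensm (idm underlying X) (idm underlying Y) = idm underlying (tens X Y);
  tensm_comp : forall (X X' X'' Y Y' Y'' : underlying)
      (f' : hom underlying X' X'') (f : hom underlying X X')
      (g' : hom underlying Y' Y'') (g : hom underlying Y Y'),
    tensm (f' \oc f) (g' \oc g) = tensm f' g' \oc tensm f g;
  tensm_linearl : forall (X X' Y Y' : underlying) (a : k)
      (f f' : hom underlying X X') (g : hom underlying Y Y'),
    tensm (a *: f + f') g = a *: tensm f g + tensm f' g;
  tensm_linearr : forall (X X' Y Y' : underlying) (a : k)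
      (f : hom underlying X X') (g g' : hom underlying Y Y'),
    tensm f (a *: g + g') = a *: tensm f g + tensm f g';
  assoc : forall X Y Z : underlying,
    hom underlying (tens (tens X Y) Z) (tens X (tens Y Z));
  assoc_inv : forall X Y Z : underlying,
    hom underlying (tens X (tens Y Z)) (tens (tens X Y) Z);
  lunit : forall X : underlying, hom underlying (tens unitob X) X;
  lunit_inv : forall X : underlying, hom underlying X (tens unitob X);
  runit : forall X : underlying, hom underlying (tens X unitob) X;
  runit_inv : forall X : underlying, hom underlying X (tens X unitob);
  assocK : forall X Y Z : underlying,
    inverse_pair (assoc X Y Z) (assoc_inv X Y Z);
  lunitK : forall X : underlying, inverse_pair (lunit X) (lunit_inv X);
  runitK : forall X : underlying, inverse_pair (runit X) (runit_inv X);
  assoc_natural : forall (X X' Y Y' Z Z' : underlying)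
      (f : hom underlying X X') (g : hom underlying Y Y')
      (h : hom underlying Z Z'),
    assoc X' Y' Z' \oc tensm (tensm f g) h =
    tensm f (tensm g h) \oc assoc X Y Z;
  lunit_natural : forall (X Y : underlying) (f : hom underlying X Y),
    lunit Y \oc tensm (idm underlying unitob) f = f \oc lunit X;
  runit_natural : forall (X Y : underlying) (f : hom underlying X Y),
    runit Y \oc tensm f (idm underlying unitob) = f \oc runit X;
  pentagon : forall W X Y Z : underlying,
    tensm (idm underlying W) (assoc X Y Z) \oc assoc W (tens X Y) Z
      \oc tensm (assoc W X Y) (idm underlying Z) =
    assoc W X (tens Y Z) \oc assoc (tens W X) Y Z;
  triangle : forall X Y : underlying,
    tensm (idm underlying X) (lunit Y) \oc assoc X unitob Y =
    tensm (runit X) (idm underlying Y)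
}.

Arguments unitob {k} C : rename.
Arguments tens {k C} X Y : rename.
Arguments tensm {k C X X' Y Y'} f g : rename.
Arguments assoc {k} C X Y Z : rename.
Arguments assoc_inv {k} C X Y Z : rename.
Arguments lunit {k} C X : rename.
Arguments lunit_inv {k} C X : rename.
Arguments runit {k} C X : rename.
Arguments runit_inv {k} C X : rename.

Notation "X \ot Y" := (tens X Y) (at level 40, left associativity) : cat_scope.
Notation "f \otm g" := (tensm f g) (at level 40, left associativity) : cat_scope.

Section Rigid.
Variables (k : fieldType) (C : monoidalCategory k).

(* [D] is a left dual of [X]; equivalently, [X] is a right dual of [D]. *)
Definition is_left_dual (X D : C) : Prop :=
  exists (ev : hom C (D \ot X) (unitob C)) (coev : hom C (unitob C) (X \ot D)),
    runit C X \oc (idm C X \otm ev) \oc assoc C X D X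
      \oc (coev \otm idm C X) \oc lunit_inv C X = idm C X /\
    lunit C D \oc (ev \otm idm C D) \oc assoc_inv C D X D
      \oc (idm C D \otm coev) \oc runit_inv C D = idm C D.

Definition rigid : Prop :=
  forall X : C, (exists D, is_left_dual X D) /\ (exists D, is_left_dual D X).

End Rigid.

Record fusionCategory (k : fieldType) := FusionCategory {
  fus_monoidal :> monoidalCategory k;
  fus_semisimple : semisimple_category fus_monoidal;
  fus_rigid : rigid fus_monoidal;
  fus_finite : exists r, @simple_representatives k fus_monoidal r;
  fus_unit_simple : @simple_ob k fus_monoidal (unitob fus_monoidal)
}.

(* A ring which is free of finite rank over Z, with a basis containing 1 and
   with structure constants in N: [sc i j l] is the coefficient of the basis
   element [l] in the product [i * j]. *)
Record basedData := BasedData {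
  basis :> finType;
  bone : basis;
  sc : basis -> basis -> basis -> nat
}.

(* A fusion ring is a unital based ring of finite rank. *)
Definition is_fusion_ring (R : basedData) : Prop :=
  [/\ forall i j l m : R,
        (\sum_(t : R) sc i j t * sc t l m = \sum_(t : R) sc j l t * sc i t m)%N,
      forall i j : R, sc (bone R) i j = (i == j),
      forall i j : R, sc i (bone R) j = (i == j)
    & exists d : R -> R,
        [/\ involutive d,
            forall i j l : R, sc (d j) (d i) (d l) = sc i j l
          & forall i j : R, sc i j (bone R) = (j == d i)]].

(* A ring isomorphism which maps the basis onto the basis. It preserves the
   duality, which is determined by [bone] and [sc]. *)
Definition fusion_ring_iso (R S : basedData) : Prop :=
  exists f : R -> S,
    [/\ bijective f, f (bone R) = bone S
      & forall i j l : R, sc (f i) (f j) (f l) = sc i j l].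

Section GrothendieckRing.
Variables (k : fieldType) (B : fusionCategory k).

Definition simples : {n : nat & 'I_n -> B} := sval (cid (fus_finite B)).

Definition simplesP : simple_representatives simples :=
  svalP (cid (fus_finite B)).

Definition unit_in_simples : exists i, isomorphic (unitob B) (projT2 simples i) :=
  let: And3 _ _ complete := simplesP in complete _ (fus_unit_simple B).

Definition decomposition (Y : B) : {m : nat & 'I_m -> B} :=
  sval (cid (proj2 (fus_semisimple B) Y)).

(* The multiplicity [Y : X] of a simple object X in Y; it does not depend on
   the decomposition of Y that is chosen (Krull-Schmidt). *)
Definition multiplicity (Y X : B) : nat :=
  #|[pred t | `[< isomorphic (projT2 (decomposition Y) t) X >]]|.

(* The free abelian group on the isomorphism classes of simple objects, with
   [X_i] * [X_j] = \sum_l [X_i (x) X_j : X_l] [X_l]. *)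
Definition K0 : basedData :=
  @BasedData 'I_(projT1 simples) (sval (cid unit_in_simples))
    (fun i j l =>
       multiplicity (projT2 simples i \ot projT2 simples j) (projT2 simples l)).

End GrothendieckRing.

(* [inl (a, b)] stands for g^a h^b and [inr c] for g^c X, so that [inr true]
   is X^* = gX. The remaining products are forced: hX = X = Xh since h occurs
   in X X^* = X^* X, and X X = g X^* X = g + gh. *)
Definition Rprime0_basis : finType := (bool * bool + bool)%type.

Definition Rprime0_mul (x y : Rprime0_basis) : seq Rprime0_basis :=
  match x, y with
  | inl (a, b), inl (c, d) => [:: inl (a (+) c, b (+) d)]
  | inl (a, _), inr c | inr c, inl (a, _) => [:: inr (a (+) c)]
  | inr c, inr d =>
      [:: inl (~~ (c (+) d), false); inl (~~ (c (+) d), true)]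
  end.

Definition Rprime0 : basedData :=
  @BasedData Rprime0_basis (inl (false, false))
    (fun x y z => count_mem z (Rprime0_mul x y)).

Definition Rprime0_dual (x : Rprime0) : Rprime0 :=
  match x with inl u => inl u | inr c => inr (~~ c) end.

Lemma Rprime0_fusion_ring : is_fusion_ring Rprime0.
Proof.
have sumE (F : Rprime0 -> nat) : (\sum_(t : Rprime0) F t =
    F (inl (true, true)) + F (inl (true, false)) + F (inl (false, true)) +
    F (inl (false, false)) + F (inr true) + F (inr false))%N.
  rewrite big_sumType /= big_bool.
  rewrite (eq_bigr (fun p => F (inl (p.1, p.2)))); last by case.
  rewrite -(pair_big xpredT xpredT (fun a b => F (inl (a, b)))) /=.
  by rewrite !big_bool /= !addnA.
split.
- move=> i j l m; rewrite !sumE.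
  by case: i => [[[] []]|[]]; case: j => [[[] []]|[]];
     case: l => [[[] []]|[]]; case: m => [[[] []]|[]].
- by case=> [[[] []]|[]]; case=> [[[] []]|[]].
- by case=> [[[] []]|[]]; case=> [[[] []]|[]].
- exists Rprime0_dual; split.
  + by case=> [[[] []]|[]].
  + by case=> [[[] []]|[]]; case=> [[[] []]|[]]; case=> [[[] []]|[]].
  + by case=> [[[] []]|[]]; case=> [[[] []]|[]].
Qed.

Lemma Rprime0_relations (g h X : Rprime0_basis) (one := bone Rprime0) :
    g = inl (true, false) -> h = inl (false, true) -> X = inr false ->
  let X' := Rprime0_dual X in
  [/\ X' <> X, Rprime0_mul g g = [:: one] /\ Rprime0_mul h h = [:: one],
      Rprime0_mul g X = [:: X'] /\ Rprime0_mul X g = [:: X']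
    & Rprime0_mul X X' = [:: one; h] /\ Rprime0_mul X' X = [:: one; h]].
Proof. by move=> -> -> ->. Qed.

(* Main.v *)
From mathcomp Require Import all_boot all_algebra.
From mathcomp Require Import boolp ring.
Require Import Defs.

(** Grade the Ising category by Z/2, with 1 and psi in degree 0 and sigma in
    degree 1, and take its product with the category of Z/4-graded vector
    spaces. The simple objects (Y, n) for which n is congruent mod 2 to the
    degree of Y span a fusion subcategory. Its six simple objects (1, 0),
    (psi, 0), (1, 2), (psi, 2), (sigma, 1), (sigma, 3) are closed under tensor
    product, and with h = (psi, 0), g = (1, 2), X = (sigma, 1) their fusion
    rules are those of R'(0): X is sigma placed in degree 1, so its dual is
    (sigma, 3) = g X, and X X* = 1 + h because sigma sigma = 1 + psi. Hence
    R'(0) is categorified by the 6j-symbols of the Ising category, transported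
    along (Y, n) |-> Y.

    Two general facts turn this into a proof.

    A semisimple category with a given finite set I of simple labels has a
    matrix model: an object is a finite set of points labelled in I, and a
    morphism is a matrix supported on pairs of points with the same label.
    Rank factorization of the blocks writes every morphism as a split
    epimorphism followed by a split monomorphism, and this alone forces
    kernels, cokernels and the normality of monos and epis
    (abelian_of_factorizations). In characteristic 0 the trace of the identity
    on the points of a given label counts these points; cyclicity of the
    trace makes the count invariant under isomorphism and additive over direct
    sums. That is the part of Krull-Schmidt by which multiplicities can be read
    from any decomposition (multiplicity_label).

    Multiplicity-free fusion rules on I with orthogonal 6j-symbols make this
    model a fusion category: the points of X (x) Y are triples (x, y, c) where
    c occurs in the product of the labels of x and y, the associator is the
    matrix of 6j-symbols, and the pentagon and triangle axioms are the
    corresponding identities between 6j-symbols. Its Grothendieck ring has the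
    given fusion rules (sixj_categorification).

    What remains is to check the 6j-symbols of the Ising category on the labels
    of R'(0). All of them are half-integral combinations of 1 and sqrt 2, so the
    identities are decided by computation in Z[sqrt 2] and then transported to
    k, which contains a square root of 2 because it is algebraically closed. *)

Set Implicit Arguments.
Unset Strict Implicit.
Unset Printing Implicit Defensive.

Import GRing.Theory.
Local Open Scope ring_scope.
Local Open Scope cat_scope.

(** * Abelian categories from split factorizations *)
Section LinearCategory.
Variables (k : fieldType) (C : linCategory k).

Lemma comp0m (X Y Z : C) (f : hom C X Y) : (0 : hom C Y Z) \oc f = 0.
Proof.
by have := comp_linearl (-1) 0 (0 : hom C Y Z) f; rewrite scaler0 add0r scaleN1r addNr.
Qed.

Lemma compm0 (X Y Z : C) (g : hom C Y Z) : g \oc (0 : hom C X Y) = 0.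
Proof.
by have := comp_linearr (-1) g 0 (0 : hom C X Y); rewrite scaler0 add0r scaleN1r addNr.
Qed.

Lemma compBl (X Y Z : C) (g g' : hom C Y Z) (f : hom C X Y) :
  (g - g') \oc f = (g \oc f) - (g' \oc f).
Proof. by rewrite addrC -scaleN1r comp_linearl scaleN1r addrC. Qed.

Lemma compBr (X Y Z : C) (g : hom C Y Z) (f f' : hom C X Y) :
  g \oc (f - f') = (g \oc f) - (g \oc f').
Proof. by rewrite addrC -scaleN1r comp_linearr scaleN1r addrC. Qed.

Lemma compZl (X Y Z : C) a (g : hom C Y Z) (f : hom C X Y) :
  (a *: g) \oc f = a *: (g \oc f).
Proof. by have := comp_linearl a g 0 f; rewrite addr0 comp0m addr0. Qed.

Lemma isomorphic_sym (X Y : C) : isomorphic X Y -> isomorphic Y X.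
Proof. by case=> f [g [gf fg]]; exists g, f. Qed.

Lemma isomorphic_trans (X Y Z : C) :
  isomorphic X Y -> isomorphic Y Z -> isomorphic X Z.
Proof.
case=> f [f' [f'f ff']] [g [g' [g'g gg']]]; exists (g \oc f), (f' \oc g').
split; first by rewrite compA -(compA f') g'g compm1 f'f.
by rewrite compA -(compA g) ff' compm1 gg'.
Qed.

(** In a semisimple category the image of a morphism is a direct summand of both
    its source and its target. *)
Definition split_factorization X Y (f : hom C X Y) : Prop :=
  exists (Z : C) (p : hom C X Z) (i : hom C Z Y) (s : hom C Z X) (r : hom C Y Z),
    [/\ f = i \oc p, p \oc s = idm C Z & r \oc i = idm C Z].

Hypothesis factor : forall (X Y : C) (f : hom C X Y), split_factorization f.

(** Cancelling the section and the retraction in e e = e for a split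
    factorization e = j q leaves q j = 1. *)
Lemma idempotent_split (X : C) (e : hom C X X) : e \oc e = e ->
  exists (Z : C) (q : hom C X Z) (j : hom C Z X),
    e = j \oc q /\ q \oc j = idm C Z.
Proof.
have [Z [q [j [s [r [-> qs rj]]]]]] := factor e => ee; exists Z, q, j; split=> //.
have := congr1 (fun u => r \oc u \oc s) ee.
by rewrite !compA rj comp1m -!compA qs compm1.
Qed.

(** For f = i p, with p split by s, the kernel of f is the kernel of p, which is
    the image of the idempotent 1 - s p. *)
Lemma kernel_exists (X Y : C) (f : hom C X Y) :
  exists K (i : hom C K X), is_kernel f i.
Proof.
have [Z [p [i [s [r [-> ps ri]]]]]] := factor f.
have [|K [q [j [eE qj]]]] := @idempotent_split X (idm C X - (s \oc p)).
  by rewrite compBl !compBr !comp1m !compm1 -compA (compA p) ps comp1m subrr subr0.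
have pj : p \oc j = 0.
  rewrite -[j]compm1 -qj (compA j) -eE compBl comp1m.
  by rewrite compBr -compA (compA p) ps comp1m subrr.
exists K, j; split; first by rewrite -compA pj compm0.
move=> T t ipt0; exists (q \oc t); split.
  rewrite compA -eE compBl comp1m.
  suff pt0: p \oc t = 0 by rewrite -compA pt0 compm0 subr0.
  by rewrite -[p]comp1m -ri -2!compA (compA i) ipt0 compm0.
by move=> u <-; rewrite compA qj comp1m.
Qed.

Lemma cokernel_exists (X Y : C) (f : hom C X Y) :
  exists Q (q : hom C Y Q), is_cokernel f q.
Proof.
have [Z [p [i [s [r [-> ps ri]]]]]] := factor f.
have [|Q [q [j [eE qj]]]] := @idempotent_split Y (idm C Y - (i \oc r)).
  by rewrite compBl !compBr !comp1m !compm1 -compA (compA r) ri comp1m subrr subr0.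
have qi : q \oc i = 0.
  rewrite -[q]comp1m -qj -(compA q) -eE compBr compm1.
  by rewrite compBl -!compA ri compm1 subrr.
exists Q, q; split; first by rewrite compA qi comp0m.
move=> T t ipt0; exists (t \oc j); split.
  rewrite -compA -eE compBr compm1.
  suff pt0: t \oc i = 0 by rewrite compA pt0 comp0m subr0.
  by rewrite -[i]compm1 -ps (compA i) (compA t) ipt0 comp0m.
by move=> u <-; rewrite -compA qj compm1.
Qed.

Lemma mono_split (X Y : C) (f : hom C X Y) : is_mono f ->
  exists r : hom C Y X, r \oc f = idm C X.
Proof.
have [Z [p [i [s [r [-> ps ri]]]]]] := factor f => monof.
exists (s \oc r); rewrite -compA (compA r) ri comp1m.
by apply: monof; rewrite -!compA (compA p) ps comp1m compm1.
Qed.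

Lemma epi_split (X Y : C) (f : hom C X Y) : is_epi f ->
  exists s : hom C Y X, f \oc s = idm C Y.
Proof.
have [Z [p [i [s [r [-> ps ri]]]]]] := factor f => epif.
exists (s \oc r); rewrite compA -(compA i) ps compm1.
by apply: epif; rewrite compA -(compA i) ri compm1 comp1m.
Qed.

(** A monomorphism i with retraction r is the kernel of 1 - i r, and an
    epimorphism q with section s is the cokernel of 1 - s q. *)
Lemma abelian_of_factorizations : additive_category C -> abelian_category C.
Proof.
split=> //.
- exact: kernel_exists.
- exact: cokernel_exists.
- move=> X Y i monoi; have [r ri] := mono_split monoi.
  exists Y, (idm C Y - (i \oc r)); split.
    by rewrite compBl comp1m -compA ri compm1 subrr.
  move=> T t /eqP; rewrite compBl comp1m subr_eq0 => /eqP tE.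
  exists (r \oc t); split=> [|u <-]; first by rewrite compA.
  by rewrite compA ri comp1m.
- move=> X Y q epiq; have [s qs] := epi_split epiq.
  exists X, (idm C X - (s \oc q)); split.
    by rewrite compBr compm1 compA qs comp1m subrr.
  move=> T t /eqP; rewrite compBr compm1 subr_eq0 => /eqP tE.
  exists (t \oc s); split=> [|u <-]; first by rewrite -compA.
  by rewrite -compA qs compm1.
Qed.

(** A subobject i of X is split by some r, so i r is an idempotent scalar: it is 0
    and the subobject vanishes, or it is 1 and i is invertible. *)
Lemma schur_simple (X : C) : idm C X != 0 ->
  (forall e : hom C X X, exists a, e = a *: idm C X) -> simple_ob X.
Proof.
move=> nz1 scal; split.
  by move=> zX; case/eqP: nz1; case: (zX X) => + _; apply.
move=> Y i monoi; have [r ri] := mono_split monoi.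
have [a irE] := scal (i \oc r).
have [a0|nza] := eqVneq a 0.
  left; suff z : idm C Y = 0.
    by move=> T; split=> f; rewrite -1?[f]comp1m -1?[f]compm1 z ?comp0m ?compm0.
  by rewrite -[idm C Y]comp1m -{1}ri -compA -ri (compA i) irE a0 scale0r comp0m compm0.
right; exists r; split=> //.
have aa : a *: (a *: idm C X) = a *: idm C X.
  have : (i \oc r) \oc (i \oc r) = i \oc r by rewrite compA -(compA i) ri compm1.
  by rewrite irE compZl comp1m.
by rewrite irE; move/(scalerI nza): aa.
Qed.

End LinearCategory.

Lemma tens_isomorphic (k : fieldType) (B : monoidalCategory k) (X X' Y Y' : B) :
  isomorphic X X' -> isomorphic Y Y' -> isomorphic (X \ot Y) (X' \ot Y').
Proof.
case=> f [f' [f'f ff']] [g [g' [g'g gg']]]; exists (f \otm g), (f' \otm g').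
by split; rewrite -tensm_comp ?f'f ?g'g ?ff' ?gg' tensm1.
Qed.

(** * Matrices between labelled finite sets *)
Section Matrices.
Variables (k : fieldType) (I : finType).

(** The points outside [live] contribute nothing to the object. They make it
    possible to index a tensor product by a plain cartesian product of types, with
    the fusion constraint recorded in [live]. *)
Record lset := LSet { pt : finType; lab : pt -> I; live : pred pt }.

Implicit Types X Y Z : lset.

Definition compat X Y (x : pt X) (y : pt Y) : bool :=
  [&& live x, live y & lab x == lab y].

(** Indexing by the compatible pairs, instead of asking a full matrix to vanish
    elsewhere, gives the structure of a finite-dimensional space for free. *)
Definition mor X Y : vectType k :=
  {ffun {p : pt X * pt Y | compat p.1 p.2} -> k^o}.

Definition mor_of X Y (M : pt X -> pt Y -> k) : mor X Y :=
  [ffun u => M (val u).1 (val u).2].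

Definition entry X Y (f : mor X Y) (x : pt X) (y : pt Y) : k :=
  if insub (x, y) is Some u then f u else 0.

Lemma entry_mor_of X Y (M : pt X -> pt Y -> k) x y :
  entry (mor_of M) x y = if compat x y then M x y else 0.
Proof.
rewrite /entry; case: insubP => [u /= -> uE|/= /negbTE-> //].
by rewrite ffunE /= uE.
Qed.

Lemma entry_compat X Y (f : mor X Y) x y : entry f x y != 0 -> compat x y.
Proof. by rewrite /entry; case: insubP => [u|] //=; rewrite eqxx. Qed.

Lemma entryP X Y (f g : mor X Y) : (forall x y, entry f x y = entry g x y) -> f = g.
Proof.
move=> fg; apply/ffunP=> u; have := fg (val u).1 (val u).2.
by rewrite /entry -surjective_pairing valK.
Qed.

Lemma entry_linear X Y a (f g : mor X Y) x y :
  entry (a *: f + g) x y = a * entry f x y + entry g x y.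
Proof.
by rewrite /entry; case: insubP => [u _ _|_]; rewrite ?ffunE // mulr0 addr0.
Qed.

Lemma entry0 X Y x y : entry (0 : mor X Y) x y = 0.
Proof. by rewrite /entry; case: insubP => [u _ _|_]; rewrite ?ffunE. Qed.

Definition mor_id X : mor X X := mor_of (fun x y => (x == y)%:R).

Definition mor_comp X Y Z (g : mor Y Z) (f : mor X Y) : mor X Z :=
  mor_of (fun x z => \sum_y entry f x y * entry g y z).

Lemma entry_id X x y : entry (mor_id X) x y = (live x && (x == y))%:R.
Proof.
rewrite entry_mor_of /compat; case: (x =P y) => [<-|_]; last by rewrite andbF if_same.
by rewrite eqxx !andbT andbb; case: (live x).
Qed.

Lemma entry_comp X Y Z (g : mor Y Z) (f : mor X Y) x z :
  entry (mor_comp g f) x z = \sum_y entry f x y * entry g y z.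
Proof.
rewrite entry_mor_of; case: ifP => // /negbT nc; rewrite big1 // => y _.
have [->|/entry_compat/and3P[ox _ /eqP xy]] := eqVneq (entry f x y) 0.
  by rewrite mul0r.
have [->|/entry_compat/and3P[_ oz /eqP yz]] := eqVneq (entry g y z) 0.
  by rewrite mulr0.
by rewrite /compat ox oz xy yz eqxx in nc.
Qed.

Lemma sum_delta (T : finType) (j : T) (F : T -> k) :
  \sum_i (j == i)%:R * F i = F j.
Proof.
rewrite (bigD1 j) //= eqxx mul1r big1 ?addr0 // => i /negbTE.
by rewrite eq_sym => ->; rewrite mul0r.
Qed.

Lemma sum_deltar (T : finType) (j : T) (F : T -> k) :
  \sum_i F i * (i == j)%:R = F j.
Proof.
by rewrite -[RHS](@sum_delta _ j); apply: eq_bigr => i _; rewrite eq_sym mulrC.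
Qed.

Lemma sum_unit (F : unit -> k) : \sum_u F u = F tt.
Proof. by rewrite (bigD1 tt) //= big1 ?addr0 // => -[]. Qed.

(** The identity matrix is the projection onto the live points. *)
Lemma sum_idl X x (F : pt X -> k) :
  \sum_y entry (mor_id X) x y * F y = (live x)%:R * F x.
Proof.
under eq_bigr => y _ do rewrite entry_id -mulnb natrM -mulrA.
by rewrite -mulr_sumr sum_delta.
Qed.

Lemma entry_livel X Y (f : mor X Y) x y : (live x)%:R * entry f x y = entry f x y.
Proof.
have [->|/entry_compat/and3P[-> _ _]] := eqVneq (entry f x y) 0.
  by rewrite mulr0.
by rewrite mul1r.
Qed.

Lemma entry_liver X Y (f : mor X Y) x y : entry f x y * (live y)%:R = entry f x y.
Proof.
have [->|/entry_compat/and3P[_ -> _]] := eqVneq (entry f x y) 0.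
  by rewrite mul0r.
by rewrite mulr1.
Qed.

Lemma mor_compA W X Y Z (h : mor Y Z) (g : mor X Y) (f : mor W X) :
  mor_comp h (mor_comp g f) = mor_comp (mor_comp h g) f.
Proof.
apply: entryP => w z; rewrite !entry_comp.
under eq_bigr => y _ do rewrite entry_comp mulr_suml.
rewrite exchange_big; apply: eq_bigr => x _; rewrite entry_comp mulr_sumr.
by apply: eq_bigr => y _; rewrite mulrA.
Qed.

Lemma mor_comp1m X Y (f : mor X Y) : mor_comp (mor_id Y) f = f.
Proof.
apply: entryP => x y; rewrite entry_comp.
under eq_bigr => z _ do rewrite entry_id -mulnb natrM mulrA entry_liver.
by rewrite sum_deltar.
Qed.

Lemma mor_compm1 X Y (f : mor X Y) : mor_comp f (mor_id X) = f.
Proof. by apply: entryP => x y; rewrite entry_comp sum_idl entry_livel. Qed.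

Lemma mor_comp_linearl X Y Z a (g g' : mor Y Z) (f : mor X Y) :
  mor_comp (a *: g + g') f = a *: mor_comp g f + mor_comp g' f.
Proof.
apply: entryP => x z; rewrite entry_linear !entry_comp mulr_sumr -big_split.
by apply: eq_bigr => y _; rewrite entry_linear mulrDr mulrCA.
Qed.

Lemma mor_comp_linearr X Y Z a (g : mor Y Z) (f f' : mor X Y) :
  mor_comp g (a *: f + f') = a *: mor_comp g f + mor_comp g f'.
Proof.
apply: entryP => x z; rewrite entry_linear !entry_comp mulr_sumr -big_split.
by apply: eq_bigr => y _; rewrite entry_linear mulrDl mulrA.
Qed.

Definition matcat : linCategory k :=
  LinCategory mor_compA mor_comp1m mor_compm1 mor_comp_linearl mor_comp_linearr.

End Matrices.

(** * Semisimplicity and multiplicities of the matrix category *)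
Section MatrixCategory.
Variables (k : fieldType) (I : finType).
Notation C := (matcat k I).
Implicit Types X Y Z : C.

(** The composition and identity of [matcat] only unfold to [mor_comp] and
    [mor_id]; this lemma and the next give the entries in a form that rewriting
    finds. *)
Lemma entry_compE X Y Z (g : hom C Y Z) (f : hom C X Y) x z :
  entry (g \oc f) x z = \sum_y entry f x y * entry g y z.
Proof. exact: entry_comp. Qed.

Lemma entry_idmE X x y : entry (idm C X) x y = (live x && (x == y))%:R.
Proof. exact: entry_id. Qed.

Definition block X Y (l : I) (f : hom C X Y) : 'M[k]_(#|pt X|, #|pt Y|) :=
  \matrix_(i, j) (if lab (enum_val i) == l
                  then entry f (enum_val i) (enum_val j) else 0).

Lemma block_rowP X Y l (f : hom C X Y) i j :
  block l f i j != 0 -> live (enum_val i) && (lab (enum_val i) == l).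
Proof.
rewrite mxE; case: ifP => [_ /entry_compat/and3P[-> _ _] //|_]; by rewrite eqxx.
Qed.

Lemma block_colP X Y l (f : hom C X Y) i j :
  block l f i j != 0 -> live (enum_val j) && (lab (enum_val j) == l).
Proof.
rewrite mxE; case: ifP => [/eqP <- /entry_compat/and3P[_ -> /eqP->]|_]; by rewrite eqxx.
Qed.

(** Each block A has a rank factorization A = P Q. The middle object has, for each
    label, as many points as the rank of the block with this label. *)
Lemma factorization X Y (f : hom C X Y) : split_factorization f.
Proof.
pose A l := block l f.
(* P and Q are the column and row bases of A, written as multiples of A so that
   their support is visibly contained in the support of A. *)
pose P l : 'M_(_, \rank (A l)) := A l *m pinvmx (row_base (A l)).
pose Q l : 'M_(\rank (A l), _) := pinvmx (col_base (A l)) *m A l.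
have PE l : P l = col_base (A l).
  have := congr1 (mulmx^~ (pinvmx (row_base (A l)))) (mulmx_base (A l)).
  by rewrite /= -mulmxA mulmxVp ?mulmx1 ?row_base_free.
have QE l : Q l = row_base (A l).
  have := congr1 (mulmx (pinvmx (col_base (A l)))) (mulmx_base (A l)).
  by rewrite mulmxA mulVpmx ?mul1mx ?col_base_full.
have P0 l i r : P l i r != 0 -> live (enum_val i) && (lab (enum_val i) == l).
  apply: contraNT => nP; rewrite mxE big1 // => j _.
  suff -> : A l i j = 0 by rewrite mul0r.
  by apply/eqP; apply: contraNT nP; apply: block_rowP.
have Q0 l r j : Q l r j != 0 -> live (enum_val j) && (lab (enum_val j) == l).
  apply: contraNT => nQ; rewrite mxE big1 // => i _.
  suff -> : A l i j = 0 by rewrite mulr0.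
  by apply/eqP; apply: contraNT nQ; apply: block_colP.
pose Z : C := @LSet I {l : I & 'I_(\rank (A l))} (fun p => tag p) xpredT.
pose p : hom C X Z := mor_of (fun x (z : pt Z) => P (tag z) (enum_rank x) (tagged z)).
pose i : hom C Z Y := mor_of (fun (z : pt Z) y => Q (tag z) (tagged z) (enum_rank y)).
pose s : hom C Z X :=
  mor_of (fun (z : pt Z) x => pinvmx (P (tag z)) (tagged z) (enum_rank x)).
pose r : hom C Y Z :=
  mor_of (fun y (z : pt Z) => pinvmx (Q (tag z)) (enum_rank y) (tagged z)).
have cfp x z : entry p x z = P (tag z) (enum_rank x) (tagged z).
  rewrite entry_mor_of /compat; case: ifP => // /negbT nc; apply/esym/eqP.
  by apply: contraNT nc => /P0; rewrite enum_rankK.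
have cfi z y : entry i z y = Q (tag z) (tagged z) (enum_rank y).
  rewrite entry_mor_of /compat; case: ifP => // /negbT nc; apply/esym/eqP.
  by apply: contraNT nc => /Q0; rewrite enum_rankK eq_sym.
exists Z, p, i, s, r; split.
- apply: entryP => x y; rewrite entry_compE.
  transitivity (\sum_l \sum_r P l (enum_rank x) r * Q l r (enum_rank y)); last first.
    by rewrite sig_big_dep; apply: eq_bigr => z _; rewrite cfp cfi.
  rewrite (eq_bigr (fun l => (lab x == l)%:R * entry f x y)) ?sum_delta // => l _.
  have := mulmx_base (A l); rewrite -PE -QE => /matrixP/(_ (enum_rank x) (enum_rank y)).
  by rewrite !mxE !enum_rankK => ->; case: (_ == _); rewrite ?mul1r ?mul0r.
- apply: entryP => z [l b]; rewrite entry_compE entry_idmE /=.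
  under eq_bigr => x _ do rewrite cfp.
  have [zl|nzl] := eqVneq (tag z) l; last first.
    rewrite big1 => [|x _]; last first.
      have [->|/P0] := eqVneq (P l (enum_rank x) b) 0.
        by rewrite mulr0.
      rewrite enum_rankK => /andP[_ /eqP xl].
      by rewrite entry_mor_of /compat xl (negbTE nzl) !andbF mul0r.
    by rewrite (_ : z == _ = false) //; apply: contraNF nzl => /eqP->.
  case: z zl => l' a /= ll'; case: _ / ll' in b *.
  rewrite eq_Tagged /=.
  have /matrixP/(_ a b) : pinvmx (P l') *m P l' = 1%:M.
    by rewrite mulVpmx // PE col_base_full.
  rewrite !mxE (reindex_onto enum_rank enum_val) => [|x _]; last exact: enum_valK.
  move=> <-; apply: eq_big => [x|x _]; first by rewrite enum_rankK eqxx.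
  rewrite entry_mor_of /compat /=; case: ifP => // /negbT nc.
  rewrite mul0r; apply/esym/eqP; rewrite mulf_eq0; apply/orP; right.
  by apply: contraNT nc => /P0; rewrite enum_rankK eq_sym.
- apply: entryP => -[l a] z; rewrite entry_compE entry_idmE /=.
  under eq_bigr => x _ do rewrite cfi.
  have [zl|nzl] := eqVneq (tag z) l; last first.
    rewrite big1 => [|y _]; last first.
      have [->|/Q0] := eqVneq (Q l a (enum_rank y)) 0.
        by rewrite mul0r.
      rewrite enum_rankK => /andP[_ /eqP yl].
      by rewrite entry_mor_of /compat yl eq_sym (negbTE nzl) !andbF mulr0.
    by rewrite (_ : _ == z = false) //; apply: contraNF nzl => /eqP<-.
  case: z zl => l' b /= ll'; case: _ / ll' in a *.
  rewrite eq_Tagged /=.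
  have /matrixP/(_ a b) : Q l' *m pinvmx (Q l') = 1%:M.
    by rewrite mulmxVp // QE row_base_free.
  rewrite !mxE (reindex_onto enum_rank enum_val) => [|x _]; last exact: enum_valK.
  move=> <-; apply: eq_big => [x|x _]; first by rewrite enum_rankK eqxx.
  rewrite entry_mor_of /compat /=; case: ifP => // /negbT nc.
  rewrite mulr0; apply/esym/eqP; rewrite mulf_eq0; apply/orP; left.
  by apply: contraNT nc => /Q0; rewrite enum_rankK.
Qed.

Definition dsum (m : nat) (s : 'I_m -> C) : C :=
  @LSet I {t : 'I_m & pt (s t)} (fun p => lab (tagged p)) (fun p => live (tagged p)).

Lemma dsumP (m : nat) (s : 'I_m -> C) : is_direct_sum s (dsum s).
Proof.
pose inj t (x : pt (s t)) : pt (dsum s) := Tagged (fun t => pt (s t)) x.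
pose i t : hom C (s t) (dsum s) := mor_of (fun x p => (inj t x == p)%:R).
pose q t : hom C (dsum s) (s t) := mor_of (fun p x => (p == inj t x)%:R).
have cfi t x p : entry (i t) x p = (inj t x == p)%:R * (live x)%:R.
  rewrite entry_mor_of /compat; case: (inj t x =P p) => [<-|_] /=; last first.
    by rewrite if_same mul0r.
  by rewrite eqxx andbT andbb mul1r; case: (live x).
have cfq t x p : entry (q t) p x = (p == inj t x)%:R * (live x)%:R.
  rewrite entry_mor_of /compat; case: (p =P inj t x) => [->|_] /=; last first.
    by rewrite if_same mul0r.
  by rewrite eqxx andbT andbb mul1r; case: (live x).
exists i, q; split.
- move=> t; apply: entryP => x y; rewrite entry_compE entry_idmE.
  under eq_bigr => z _ do rewrite cfi cfq -mulrA.
  rewrite sum_delta eq_Tagged /= -!natrM !mulnb; congr (_ %:R).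
  by case: eqP => [->|_]; rewrite ?andbF // andbb andbT.
- move=> t u ntu; apply: entryP => x y; rewrite entry_compE entry0.
  under eq_bigr => z _ do rewrite cfi cfq -mulrA.
  rewrite sum_delta (_ : _ == _ = false) ?mul0r ?mulr0 //.
  by apply: contraNF ntu => /eqP/(congr1 tag)/= ->.
apply: entryP => p p'; rewrite entry_idmE.
have -> : entry (\sum_t (i t \oc q t)) p p' = \sum_t entry (i t \oc q t) p p'.
  by apply: (big_morph (fun f : hom C _ _ => entry f p p')) => [f g|];
     rewrite ?entry0 // -[f]scale1r entry_linear mul1r scale1r.
under eq_bigr => t _ do rewrite entry_compE.
rewrite sig_big_dep /=.
rewrite (eq_bigr (fun r => (p == r)%:R * (live (tagged r) && (r == p'))%:R)).
  by rewrite sum_delta.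
case=> t x _; rewrite cfi cfq /= -!mulrA; congr (_ * _).
by rewrite -!natrM !mulnb; congr (nat_of_bool _)%:R; rewrite andbCA andbb andbC.
Qed.

Lemma matcat_additive : additive_category C.
Proof.
split; last first.
  move=> X1 X2; exists (dsum (fun t : 'I_2 => if t == ord0 then X1 else X2)).
  exact: dsumP.
exists (@LSet I void (fun x => match x with end) xpredT) => T.
by split=> f; apply: entryP => // ? [].
Qed.

Lemma matcat_abelian : abelian_category C.
Proof. exact: abelian_of_factorizations factorization matcat_additive. Qed.

Definition point (l : I) : C := @LSet I unit (fun=> l) xpredT.

Lemma point_simple l : simple_ob (point l).
Proof.
apply: schur_simple factorization _ _ _.
  apply/eqP=> /(congr1 (fun f : hom C (point l) (point l) => entry f tt tt)).
  rewrite entry_idmE entry0.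
  by apply/eqP; rewrite oner_eq0.
move=> e; exists (entry e tt tt); apply: entryP => -[] [].
by rewrite -[_ *: _]addr0 entry_linear entry0 addr0 entry_idmE mulr1.
Qed.

(** A collective copy of [live], for cardinals and enumeration. *)
Definition live_points X : {pred pt X} := @live I X.
Arguments live_points X : clear implicits.

Lemma point_sum X :
  is_direct_sum (fun t : 'I_#|live_points X| => point (lab (enum_val t))) X.
Proof.
pose i (t : 'I_#|live_points X|) : hom C (point (lab (enum_val t))) X :=
  mor_of (fun _ x => (enum_val t == x)%:R).
pose q (t : 'I_#|live_points X|) : hom C X (point (lab (enum_val t))) :=
  mor_of (fun x _ => (x == enum_val t)%:R).
have onv (t : 'I_#|live_points X|) : live (enum_val t) by exact: enum_valP t.
have cfi t u x : entry (i t) u x = (enum_val t == x)%:R.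
  rewrite entry_mor_of /compat /=; case: (_ =P x) => [<-|_]; last by rewrite if_same.
  by rewrite onv eqxx.
have cfq t u x : entry (q t) x u = (x == enum_val t)%:R.
  rewrite entry_mor_of /compat /=; case: (x =P _) => [->|_]; last by rewrite if_same.
  by rewrite onv eqxx.
exists i, q; split.
- move=> t; apply: entryP => -[] []; rewrite entry_compE entry_idmE.
  under eq_bigr => z _ do rewrite cfi cfq.
  by rewrite sum_delta eqxx.
- move=> t u ntu; apply: entryP => -[] []; rewrite entry_compE entry0.
  under eq_bigr => z _ do rewrite cfi cfq.
  by rewrite sum_delta (inj_eq enum_val_inj) (negbTE ntu).
apply: entryP => x y; rewrite entry_idmE.
have -> : entry (\sum_t (i t \oc q t)) x y = \sum_t entry (i t \oc q t) x y.
  by apply: (big_morph (fun f : hom C _ _ => entry f x y)) => [f g|];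
     rewrite ?entry0 // -[f]scale1r entry_linear mul1r scale1r.
transitivity (\sum_(z in live_points X) (x == z)%:R * (z == y)%:R : k).
  rewrite [RHS]big_enum_val; apply: eq_bigr => t _.
  by rewrite entry_compE /= sum_unit cfi cfq.
transitivity (\sum_z (x == z)%:R * ((z == y)%:R * (live z)%:R) : k).
  rewrite big_mkcond; apply: eq_bigr => z _.
  by rewrite -[z \in live_points X]/(live z); case: (live z); rewrite !(mulr1, mulr0).
by rewrite sum_delta -natrM mulnb andbC.
Qed.

Lemma matcat_semisimple : semisimple_category C.
Proof.
split=> [|X]; first exact: matcat_abelian.
exists (existT (fun m => 'I_m -> C) _
  (fun t : 'I_#|live_points X| => point (lab (enum_val t)))).
by split=> [t|]; [apply: point_simple | apply: point_sum].
Qed.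

(** A live point x spans a nonzero subobject, which simplicity makes everything. *)
Lemma simple_point X : simple_ob X -> exists l, isomorphic X (point l).
Proof.
case=> nzX minX.
have [x ox] : exists x : pt X, live x.
  apply: contrapT => nox; apply: nzX => T.
  by split=> f; apply: entryP => x y; rewrite entry0; apply/eqP; apply: contraT;
    move/entry_compat/and3P=> [? ? _]; case: nox; eexists; eassumption.
pose i : hom C (point (lab x)) X := mor_of (fun _ y => (x == y)%:R).
pose q : hom C X (point (lab x)) := mor_of (fun y _ => (x == y)%:R).
have qi : q \oc i = idm C _.
  apply: entryP => -[] []; rewrite entry_compE entry_idmE.
  under eq_bigr => y _.
    rewrite !entry_mor_of /compat /= (_ : (if _ then _ else 0) = (x == y)%:R); last first.
      by case: (x =P y) => [<-|_]; rewrite ?if_same // ox eqxx.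
  over.
  by rewrite sum_delta ox !eqxx.
case: (minX _ i) => [T u v /(congr1 (comp q))|zP|isoi].
- by rewrite !compA qi !comp1m.
- by case: (point_simple (lab x)) => /(_ zP).
exists (lab x); apply: isomorphic_sym; exact: (ex_intro _ i).
Qed.

Definition label_trace (l : I) X (f : hom C X X) : k :=
  \sum_(x : pt X) (lab x == l)%:R * entry f x x.

(** The trace restricted to one label is still cyclic, because a nonzero entry
    joins points with the same label. *)
Lemma label_traceC l X Y (f : hom C X Y) (g : hom C Y X) :
  label_trace l (g \oc f) = label_trace l (f \oc g).
Proof.
rewrite /label_trace; under eq_bigr => x _ do rewrite entry_compE mulr_sumr.
rewrite exchange_big; apply: eq_bigr => y _; rewrite entry_compE mulr_sumr.
apply: eq_bigr => x _; rewrite [entry g y x * _]mulrC.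
have [->|/entry_compat/and3P[_ _ /eqP->] //] := eqVneq (entry f x y) 0.
by rewrite mul0r !mulr0.
Qed.

Definition label_count (l : I) X : nat := #|[pred x : pt X | live x && (lab x == l)]|.

Lemma label_trace_id l X : label_trace l (idm C X) = (label_count l X)%:R.
Proof.
rewrite /label_trace /label_count -sum1_card natr_sum [RHS]big_mkcond.
apply: eq_bigr => x _; rewrite entry_idmE eqxx andbT -natrM mulnb andbC.
by rewrite -topredE /=; case: (_ && _).
Qed.

Hypothesis char0 : [pchar k] =i pred0.

Lemma natr_inj0 : injective (fun n => n%:R : k).
Proof.
have inj0 m n : (m <= n)%N -> m%:R = n%:R :> k -> m = n.
  move=> le /esym/eqP; rewrite -subr_eq0 -natrB //.
  have /pcharf0P-> := char0; rewrite subn_eq0 => le'.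
  by apply/eqP; rewrite eqn_leq le le'.
move=> m n e; case/orP: (leq_total m n) => le; first exact: inj0.
exact/esym/inj0.
Qed.

(** With gf = 1 and fg = 1 the two counts are the traces of gf and of fg, and in
    characteristic 0 a natural number is determined by its image in k. *)
Lemma label_count_iso l X Y : isomorphic X Y -> label_count l X = label_count l Y.
Proof.
case=> f [g [gf fg]]; apply: natr_inj0.
by rewrite -!label_trace_id -gf -fg label_traceC.
Qed.

(** The identity of Y is the sum of the projectors i_t q_t, and the trace of i_t q_t
    is that of q_t i_t = 1. *)
Lemma label_count_sum l m (s : 'I_m -> C) Y : is_direct_sum s Y ->
  label_count l Y = (\sum_t label_count l (s t))%N.
Proof.
case=> i [q [qi _ iq]]; apply: natr_inj0; rewrite natr_sum -label_trace_id -iq.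
rewrite (big_morph (@label_trace l Y) (id1 := 0) (op1 := +%R)).
- by apply: eq_bigr => t _; rewrite label_traceC qi label_trace_id.
- move=> f g; rewrite /label_trace -big_split; apply: eq_bigr => x _.
  by rewrite -[f]scale1r entry_linear mul1r scale1r mulrDr.
by rewrite /label_trace big1 // => x _; rewrite entry0 mulr0.
Qed.

Lemma label_count_point l l' : label_count l (point l') = (l' == l).
Proof.
rewrite /label_count; case: (l' == l) => /=; first exact: card_unit.
by apply: eq_card0.
Qed.

Lemma point_inj l l' : isomorphic (point l) (point l') -> l = l'.
Proof.
move=> /(label_count_iso l); rewrite !label_count_point eqxx.
by case: eqP.
Qed.

End MatrixCategory.

(** * The monoidal category of a system of 6j-symbols *)

(** [adm i j l] says that l occurs, necessarily once, in the product of i and j.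
    [sixF i j l d e f] is the entry of the associator of i, j, l on the component
    d, from the channel e of i j to the channel f of j l. The symbols are taken
    orthogonal, so that the inverse associator is given by the transpose. The last
    two fields make a single normalization satisfy both duality equations. *)
Record sixj (k : fieldType) (I : finType) := SixJ {
  unit_label : I;
  dual_label : I -> I;
  adm : I -> I -> I -> bool;
  sixF : I -> I -> I -> I -> I -> I -> k;
  adm1l : forall i j, adm unit_label i j = (i == j);
  adm1r : forall i j, adm i unit_label j = (i == j);
  dual_dual : involutive dual_label;
  adm_dual : forall i, adm i (dual_label i) unit_label;
  sixF_adm : forall i j l d e f, sixF i j l d e f != 0 ->
    [&& adm i j e, adm e l d, adm j l f & adm i f d];
  sixF_row : forall i j l d e e',
    \sum_f sixF i j l d e f * sixF i j l d e' f =
    [&& e == e', adm i j e & adm e l d]%:R;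
  sixF_col : forall i j l d f f',
    \sum_e sixF i j l d e f * sixF i j l d e f' =
    [&& f == f', adm j l f & adm i f d]%:R;
  sixF_pentagon : forall i j l m e f u g h,
    \sum_x sixF i j l f e x * sixF i x m u f h * sixF j l m h x g =
    sixF e l m u f g * sixF i j g u e h;
  sixF_triangle : forall i j d, adm i j d -> sixF i unit_label j d i j = 1;
  sixF_dual : forall i,
    sixF i (dual_label i) i i unit_label unit_label =
    sixF (dual_label i) i (dual_label i) (dual_label i) unit_label unit_label;
  sixF_dual_neq0 : forall i,
    sixF i (dual_label i) i i unit_label unit_label != 0
}.

Section Monoidal.
Variables (k : fieldType) (I : finType) (S : sixj k I).
Notation C := (matcat k I).
Notation F := (sixF S).
Notation N := (adm S).
Implicit Types X Y Z : C.

(** The matrices of the associator and of the unitors are supported on the graph of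
    an injective correspondence of points; this lemma collapses the sums over
    their rows. *)
Lemma sum_supp (T U : finType) (h : U -> T) (G : T -> k) : injective h ->
  (forall q, G q != 0 -> exists u, q = h u) -> \sum_q G q = \sum_u G (h u).
Proof.
move=> injh suppG; under [RHS]eq_bigr => u _ do rewrite -(sum_delta (h u)).
rewrite exchange_big; apply: eq_bigr => q _; rewrite -mulr_suml.
have [->|/suppG[u0 ->]] := eqVneq (G q) 0; first by rewrite mulr0.
under eq_bigr => u _ do rewrite (inj_eq injh) -[_%:R]mul1r.
by rewrite sum_deltar mul1r.
Qed.

Lemma sum_triple (A B D : finType) (G : A * B * D -> k) :
  \sum_p G p = \sum_a \sum_b \sum_c G (a, b, c).
Proof.
transitivity (\sum_(p : A * B) \sum_c G (p, c)).
  by rewrite [RHS]pair_bigA; apply: eq_bigr => -[].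
by rewrite [RHS]pair_bigA; apply: eq_bigr => -[].
Qed.

Lemma natr_andb (a b : bool) : (a && b)%:R = a%:R * b%:R :> k.
Proof. by rewrite -natrM mulnb. Qed.

Definition unit_ob : C := point k (unit_label S).

Definition tens_ob X Y : C :=
  @LSet I (pt X * pt Y * I)%type snd
    (fun p => [&& live p.1.1, live p.1.2 & N (lab p.1.1) (lab p.1.2) p.2]).

Definition tens_mor X X' Y Y' (f : hom C X X') (g : hom C Y Y') :
    hom C (tens_ob X Y) (tens_ob X' Y') :=
  mor_of (fun (p : pt (tens_ob X Y)) (q : pt (tens_ob X' Y')) =>
    (p.2 == q.2)%:R * (entry f p.1.1 q.1.1 * entry g p.1.2 q.1.2)).

Lemma entry_tensm X X' Y Y' (f : hom C X X') (g : hom C Y Y') x y c x' y' c' :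
  entry (tens_mor f g) (x, y, c) (x', y', c') =
  (N (lab x) (lab y) c && (c == c'))%:R * (entry f x x' * entry g y y').
Proof.
rewrite entry_mor_of /compat /=.
have [->|/entry_compat/and3P[ox ox' /eqP xx']] := eqVneq (entry f x x') 0.
  by rewrite mul0r !mulr0 if_same.
have [->|/entry_compat/and3P[oy oy' /eqP yy']] := eqVneq (entry g y y') 0.
  by rewrite !mulr0 if_same.
rewrite ox oy ox' oy' xx' yy' /=; case: eqP => [->|_]; last first.
  by rewrite !andbF !mul0r.
by case: (N _ _ _); rewrite /= ?mul0r.
Qed.

(** [K] is meant to be a column of the next matrix in a composite: the entries of
    composites are computed by such row sums, from the source onwards. *)
Lemma sum_tensm X X' Y Y' (f : hom C X X') (g : hom C Y Y') x y c K :
  \sum_q entry (tens_mor f g) (x, y, c) q * K q =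
  (N (lab x) (lab y) c)%:R * \sum_x' \sum_y' entry f x x' * entry g y y' * K (x', y', c).
Proof.
rewrite [LHS]sum_triple mulr_sumr; apply: eq_bigr => x' _.
rewrite mulr_sumr; apply: eq_bigr => y' _.
under eq_bigr => c' _ do rewrite entry_tensm -mulnb natrM -!mulrA mulrCA.
by rewrite sum_delta !mulrA.
Qed.

Lemma sum_tensm1 X X' Y (f : hom C X X') x y c K :
  \sum_q entry (tens_mor f (idm C Y)) (x, y, c) q * K q =
  (live y && N (lab x) (lab y) c)%:R * \sum_x' entry f x x' * K (x', y, c).
Proof.
rewrite sum_tensm andbC -mulnb natrM -mulrA; congr (_ * _).
rewrite mulr_sumr; apply: eq_bigr => x' _.
under eq_bigr => y' _ do rewrite -mulrA.
by rewrite -mulr_sumr sum_idl mulrCA.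
Qed.

Lemma tens_mor1 X Y : tens_mor (idm C X) (idm C Y) = idm C (tens_ob X Y).
Proof.
apply: entryP => -[[x y] c] [[x' y'] c']; rewrite entry_tensm !entry_idmE -!natrM !mulnb.
congr (nat_of_bool _)%:R; rewrite /= !xpair_eqE.
by case: (live x); case: (live y); case: (x == x'); case: (y == y'); case: (N _ _ _);
  case: (c == c').
Qed.

Lemma tens_mor_comp X X' X'' Y Y' Y'' (f' : hom C X' X'') (f : hom C X X')
    (g' : hom C Y' Y'') (g : hom C Y Y') :
  tens_mor (f' \oc f) (g' \oc g) = (tens_mor f' g' : hom C _ _) \oc tens_mor f g.
Proof.
apply: entryP => -[[x y] c] [[x'' y''] c''].
rewrite entry_tensm !entry_compE sum_tensm.
case Nxy: (N _ _ _); last by rewrite !mul0r.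
rewrite mul1r !mulr_suml mulr_sumr; apply: eq_bigr => x' _.
rewrite !mulr_sumr; apply: eq_bigr => y' _; rewrite entry_tensm.
have [->|/entry_compat/and3P[_ _ /eqP <-]] := eqVneq (entry f x x') 0.
  by ring.
have [->|/entry_compat/and3P[_ _ /eqP <-]] := eqVneq (entry g y y') 0.
  by ring.
by rewrite Nxy /=; ring.
Qed.

Lemma tens_mor_linearl X X' Y Y' (a : k) (f f' : hom C X X') (g : hom C Y Y') :
  tens_mor (a *: f + f') g = a *: tens_mor f g + tens_mor f' g.
Proof.
apply: entryP => -[[x y] c] [[x' y'] c'].
by rewrite entry_linear !entry_tensm entry_linear; ring.
Qed.

Lemma tens_mor_linearr X X' Y Y' (a : k) (f : hom C X X') (g g' : hom C Y Y') :
  tens_mor f (a *: g + g') = a *: tens_mor f g + tens_mor f g'.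
Proof.
apply: entryP => -[[x y] c] [[x' y'] c'].
by rewrite entry_linear !entry_tensm entry_linear; ring.
Qed.

Definition assoc_mor X Y Z :
    hom C (tens_ob (tens_ob X Y) Z) (tens_ob X (tens_ob Y Z)) :=
  mor_of (fun (p : pt (tens_ob (tens_ob X Y) Z)) (q : pt (tens_ob X (tens_ob Y Z))) =>
    let: (x, y, e, z, d) := p in let: (x', (y', z', f), d') := q in
    ((x, y, z, d) == (x', y', z', d'))%:R * F (lab x) (lab y) (lab z) d e f).

Definition assoc_mor_inv X Y Z :
    hom C (tens_ob X (tens_ob Y Z)) (tens_ob (tens_ob X Y) Z) :=
  mor_of (fun (p : pt (tens_ob X (tens_ob Y Z))) (q : pt (tens_ob (tens_ob X Y) Z)) =>
    let: (x, (y, z, f), d) := p in let: (x', y', e, z', d') := q in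
    ((x, y, z, d) == (x', y', z', d'))%:R * F (lab x) (lab y) (lab z) d e f).

Lemma entry_assoc X Y Z x y e z d x' y' z' f d' :
  entry (assoc_mor X Y Z) (x, y, e, z, d) (x', (y', z', f), d') =
  [&& live x, live y & live z]%:R * (((x, y, z, d) == (x', y', z', d'))%:R *
    F (lab x) (lab y) (lab z) d e f).
Proof.
rewrite entry_mor_of /compat /=.
case: (_ =P (x', y', z', d')) => [[<- <- <- <-]|_]; last first.
  by rewrite mul0r mulr0 if_same.
have [->|/sixF_adm/and4P[-> -> -> ->]] := eqVneq (F (lab x) (lab y) (lab z) d e f) 0.
  by rewrite !mulr0 if_same.
by rewrite eqxx !andbT; case: (live x); case: (live y); case: (live z);
  rewrite /= ?mul0r ?mul1r.
Qed.

Lemma entry_assoc_inv X Y Z x y e z d x' y' z' f d' :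
  entry (assoc_mor_inv X Y Z) (x, (y, z, f), d) (x', y', e, z', d') =
  [&& live x, live y & live z]%:R * (((x, y, z, d) == (x', y', z', d'))%:R *
    F (lab x) (lab y) (lab z) d e f).
Proof.
rewrite entry_mor_of /compat /=.
case: (_ =P (x', y', z', d')) => [[<- <- <- <-]|_]; last first.
  by rewrite mul0r mulr0 if_same.
have [->|/sixF_adm/and4P[-> -> -> ->]] := eqVneq (F (lab x) (lab y) (lab z) d e f) 0.
  by rewrite !mulr0 if_same.
by rewrite eqxx !andbT; case: (live x); case: (live y); case: (live z);
  rewrite /= ?mul0r ?mul1r.
Qed.

Lemma sum_assoc X Y Z x y e z d K :
  \sum_q entry (assoc_mor X Y Z) (x, y, e, z, d) q * K q =
  [&& live x, live y & live z]%:R *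
    \sum_f F (lab x) (lab y) (lab z) d e f * K (x, (y, z, f), d).
Proof.
rewrite (sum_supp (h := fun f => (x, (y, z, f), d))) => [|? ? [] //|].
  by rewrite mulr_sumr; apply: eq_bigr => f _; rewrite entry_assoc eqxx /=; ring.
move=> [[x' [[y' z'] f]] d']; rewrite entry_assoc.
case: (_ =P (x', y', z', d')) => [[<- <- <- <-]|_]; first by exists f.
by rewrite mul0r mulr0 mul0r eqxx.
Qed.

Lemma sum_assoc_inv X Y Z x y f z d K :
  \sum_q entry (assoc_mor_inv X Y Z) (x, (y, z, f), d) q * K q =
  [&& live x, live y & live z]%:R *
    \sum_e F (lab x) (lab y) (lab z) d e f * K (x, y, e, z, d).
Proof.
rewrite (sum_supp (h := fun e => (x, y, e, z, d))) => [|? ? [] //|].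
  by rewrite mulr_sumr; apply: eq_bigr => e _; rewrite entry_assoc_inv eqxx /=; ring.
move=> [[[[x' y'] e] z'] d']; rewrite entry_assoc_inv.
case: (_ =P (x', y', z', d')) => [[<- <- <- <-]|_]; first by exists e.
by rewrite mul0r mulr0 mul0r eqxx.
Qed.

Lemma assoc_morK X Y Z : inverse_pair (assoc_mor X Y Z) (assoc_mor_inv X Y Z).
Proof.
split; apply: entryP.
  move=> [[[[x y] e] z] d] [[[[x' y'] e'] z'] d'].
  rewrite entry_compE sum_assoc entry_idmE.
  under eq_bigr => f _ do rewrite entry_assoc_inv mulrCA [X in _ * X]mulrCA.
  rewrite -!mulr_sumr.
  have -> : ((x, y, e, z, d) == (x', y', e', z', d')) =
            ((x, y, z, d) == (x', y', z', d')) && (e == e').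
    by rewrite !xpair_eqE; do !case: (_ == _).
  case: (_ == (x', y', z', d')); last by rewrite mul0r !mulr0 andbF.
  rewrite sixF_row -!natrM !mulnb; congr (nat_of_bool _)%:R.
  by rewrite /=; case: (live x); case: (live y); case: (live z); case: (e == e');
     rewrite ?andbT ?andbF.
move=> [[x [[y z] f]] d] [[x' [[y' z'] f']] d'].
rewrite entry_compE sum_assoc_inv entry_idmE.
under eq_bigr => e _ do rewrite entry_assoc mulrCA [X in _ * X]mulrCA.
rewrite -!mulr_sumr.
have -> : ((x, (y, z, f), d) == (x', (y', z', f'), d')) =
          ((x, y, z, d) == (x', y', z', d')) && (f == f').
  by rewrite !xpair_eqE; do !case: (_ == _).
case: (_ == (x', y', z', d')); last by rewrite mul0r !mulr0 andbF.
rewrite sixF_col -!natrM !mulnb; congr (nat_of_bool _)%:R.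
by rewrite /=; case: (live x); case: (live y); case: (live z); case: (f == f');
   rewrite ?andbT ?andbF.
Qed.

Lemma assoc_mor_natural X X' Y Y' Z Z' (f : hom C X X') (g : hom C Y Y') (h : hom C Z Z') :
  assoc_mor X' Y' Z' \oc tens_mor (tens_mor f g) h =
  (tens_mor f (tens_mor g h) : hom C _ _) \oc assoc_mor X Y Z.
Proof.
apply: entryP => -[[[[x y] e] z] d] [[x' [[y' z'] m]] d'].
rewrite !entry_compE sum_assoc.
rewrite (sum_supp (h := fun e => (x', y', e, z', d'))) => [|? ? [] //|]; last first.
  move=> [[[[x1 y1] e1] z1] d1]; rewrite entry_assoc.
  case: (_ =P (x', y', z', d')) => [[-> -> -> ->]|_]; first by exists e1.
  by rewrite mul0r !mulr0 eqxx.
rewrite (eq_bigr (fun e' => (e == e')%:R *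
    ((N e (lab z) d && (d == d'))%:R * (N (lab x) (lab y) e)%:R *
     (entry f x x' * entry g y y' * entry h z z') * [&& live x', live y' & live z']%:R *
     F (lab x') (lab y') (lab z') d' e' m))); last first.
  move=> e' _; rewrite !entry_tensm entry_assoc eqxx /=.
  by rewrite [(N (lab x) (lab y) e && _)%:R]natr_andb; ring.
rewrite sum_delta.
rewrite (eq_bigr (fun m' => (m' == m)%:R *
    ((N (lab x) m' d && (d == d'))%:R * (N (lab y) (lab z) m')%:R *
     (entry f x x' * entry g y y' * entry h z z') *
     F (lab x) (lab y) (lab z) d e m'))); last first.
  move=> m' _; rewrite !entry_tensm.
  by rewrite [(N (lab y) (lab z) m' && _)%:R]natr_andb; ring.
under [in RHS]eq_bigr => m' _ do rewrite mulrC.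
rewrite sum_deltar.
have [->|/entry_compat/and3P[ox ox' /eqP xx']] := eqVneq (entry f x x') 0.
  by ring.
have [->|/entry_compat/and3P[oy oy' /eqP yy']] := eqVneq (entry g y y') 0.
  by ring.
have [->|/entry_compat/and3P[oz oz' /eqP zz']] := eqVneq (entry h z z') 0.
  by ring.
rewrite -xx' -yy' -zz' ox oy oz ox' oy' oz'.
case: (d =P d') => [<-|_]; last by rewrite !andbF !mul0r mulr0.
have [->|/sixF_adm/and4P[-> -> -> ->]] := eqVneq (F (lab x) (lab y) (lab z) d e m) 0.
  by ring.
by rewrite /=; ring.
Qed.

(** Both sides vanish unless the outer points agree; the remaining entry is the
    pentagon identity of the 6j-symbols, where x ranges over the channels of the
    middle two factors. *)
Lemma assoc_mor_pentagon W X Y Z :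
  (tens_mor (idm C W) (assoc_mor X Y Z) : hom C _ _) \oc assoc_mor W (tens_ob X Y) Z
      \oc tens_mor (assoc_mor W X Y) (idm C Z) =
  (assoc_mor W X (tens_ob Y Z) : hom C _ _) \oc assoc_mor (tens_ob W X) Y Z.
Proof.
apply: entryP => -[[[[[[w x] e] y] f] z] u] [[w' [[x' [[y' z'] g]] h]] u'].
rewrite !entry_compE sum_tensm1 sum_assoc.
under eq_bigr => t _.
  rewrite entry_compE sum_assoc /=.
  rewrite (eq_bigr (fun h' => (h' == h)%:R * (
     (N (lab w) h' u && (u == u'))%:R * ((live w && (w == w'))%:R *
     ([&& live x, live y & live z]%:R * (((x, y, z) == (x', y', z'))%:R *
     (F (lab w) t (lab z) u f h' * F (lab x) (lab y) (lab z) h' t g))))))); last first.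
    move=> h' _; rewrite entry_tensm entry_assoc entry_idmE.
    by rewrite (xpair_eqE (x, y, z)) ![(_ && (h' == h))%:R]natr_andb; ring.
  under eq_bigr => h' _ do rewrite mulrC.
  rewrite sum_deltar.
  over.
rewrite [in RHS]sum_assoc /=.
rewrite [in RHS](eq_bigr (fun g' => (g' == g)%:R *
   ([&& live w, live x, live y, live z & N (lab y) (lab z) g']%:R *
     (((w, x, y, z, u) == (w', x', y', z', u'))%:R *
     (F e (lab y) (lab z) u f g' * F (lab w) (lab x) g' u e h))))); last first.
  move=> g' _; rewrite entry_assoc /= !xpair_eqE !natr_andb; ring.
under [in RHS]eq_bigr => g' _ do rewrite mulrC.
rewrite sum_deltar.
(* The admissibility conditions left over on either side are implied by the 6j
   symbols that they multiply, so that c is the common factor. *)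
pose c : k := ([&& live w, live x, live y & live z] &&
               ((w, x, y, z, u) == (w', x', y', z', u')))%:R.
transitivity (c * (F e (lab y) (lab z) u f g * F (lab w) (lab x) g u e h)).
  rewrite -sixF_pentagon !mulr_sumr; apply: eq_bigr => t _; rewrite {}/c.
  have [->|/sixF_adm/and4P[_ _ -> _]] := eqVneq (F (lab w) (lab x) (lab y) f e t) 0.
    by ring.
  have [->|/sixF_adm/and4P[_ -> _ ->]] := eqVneq (F (lab w) t (lab z) u f h) 0.
    by ring.
  rewrite !xpair_eqE !andbT !natr_andb.
  by case: (live w); case: (live x); case: (live y); case: (live z);
    rewrite /= ?mulr0n; ring.
rewrite {}/c.
have [->|/sixF_adm/and4P[_ _ -> _]] := eqVneq (F e (lab y) (lab z) u f g) 0.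
  by ring.
have [->|/sixF_adm/and4P[-> _ _ _]] := eqVneq (F (lab w) (lab x) g u e h) 0.
  by ring.
rewrite !andbT; case: (_ == _); case: (live w); case: (live x); case: (live y);
  case: (live z); by rewrite /= ?mulr0n; ring.
Qed.

Definition lunit_mor X : hom C (tens_ob unit_ob X) X :=
  mor_of (fun (p : pt (tens_ob unit_ob X)) x => (p.1.2 == x)%:R).
Definition lunit_mor_inv X : hom C X (tens_ob unit_ob X) :=
  mor_of (fun x (p : pt (tens_ob unit_ob X)) => (p.1.2 == x)%:R).
Definition runit_mor X : hom C (tens_ob X unit_ob) X :=
  mor_of (fun (p : pt (tens_ob X unit_ob)) x => (p.1.1 == x)%:R).
Definition runit_mor_inv X : hom C X (tens_ob X unit_ob) :=
  mor_of (fun x (p : pt (tens_ob X unit_ob)) => (p.1.1 == x)%:R).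

Lemma entry_lunit X t x c x' :
  entry (lunit_mor X) (t, x, c) x' = (live x && (c == lab x))%:R * (x == x')%:R.
Proof.
rewrite entry_mor_of /compat /= adm1l; case: (x =P x') => [<-|_]; last first.
  by rewrite mulr0 if_same.
by rewrite mulr1 (eq_sym c); case: (live x); case: (lab x == c).
Qed.

Lemma entry_lunit_inv X t x c x' :
  entry (lunit_mor_inv X) x' (t, x, c) = (live x && (c == lab x))%:R * (x == x')%:R.
Proof.
rewrite entry_mor_of /compat /= adm1l; case: (x =P x') => [<-|_]; last first.
  by rewrite mulr0 if_same.
by rewrite mulr1 (eq_sym c); case: (live x); case: (lab x == c).
Qed.

Lemma entry_runit X t x c x' :
  entry (runit_mor X) (x, t, c) x' = (live x && (c == lab x))%:R * (x == x')%:R.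
Proof.
rewrite entry_mor_of /compat /= adm1r; case: (x =P x') => [<-|_]; last first.
  by rewrite mulr0 if_same.
by rewrite mulr1 (eq_sym c); case: (live x); case: (lab x == c).
Qed.

Lemma entry_runit_inv X t x c x' :
  entry (runit_mor_inv X) x' (x, t, c) = (live x && (c == lab x))%:R * (x == x')%:R.
Proof.
rewrite entry_mor_of /compat /= adm1r; case: (x =P x') => [<-|_]; last first.
  by rewrite mulr0 if_same.
by rewrite mulr1 (eq_sym c); case: (live x); case: (lab x == c).
Qed.

Lemma sum_lunit_inv X x K :
  \sum_p entry (lunit_mor_inv X) x p * K p = (live x)%:R * K (tt, x, lab x).
Proof.
rewrite (sum_supp (h := fun _ : unit => (tt, x, lab x))) => [|[] [] //|].
  by rewrite sum_unit entry_lunit_inv !eqxx andbT mulr1.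
move=> [[[] x1] c]; rewrite entry_lunit_inv.
case: (x1 =P x) => [->|_]; last by rewrite !(mulr0, mul0r) eqxx.
case: (c =P lab x) => [->|_]; first by exists tt.
by rewrite andbF !mul0r eqxx.
Qed.

Lemma sum_runit_inv X x K :
  \sum_p entry (runit_mor_inv X) x p * K p = (live x)%:R * K (x, tt, lab x).
Proof.
rewrite (sum_supp (h := fun _ : unit => (x, tt, lab x))) => [|[] [] //|].
  by rewrite sum_unit entry_runit_inv !eqxx andbT mulr1.
move=> [[x1 []] c]; rewrite entry_runit_inv.
case: (x1 =P x) => [->|_]; last by rewrite !(mulr0, mul0r) eqxx.
case: (c =P lab x) => [->|_]; first by exists tt.
by rewrite andbF !mul0r eqxx.
Qed.

Lemma sum_lunit X t x c K :
  \sum_x' entry (lunit_mor X) (t, x, c) x' * K x' = (live x && (c == lab x))%:R * K x.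
Proof.
under eq_bigr => x' _ do rewrite entry_lunit -mulrA.
by rewrite -mulr_sumr sum_delta.
Qed.

Lemma sum_runit X t x c K :
  \sum_x' entry (runit_mor X) (x, t, c) x' * K x' = (live x && (c == lab x))%:R * K x.
Proof.
under eq_bigr => x' _ do rewrite entry_runit -mulrA.
by rewrite -mulr_sumr sum_delta.
Qed.

Lemma lunit_morK X : inverse_pair (lunit_mor X) (lunit_mor_inv X).
Proof.
split; apply: entryP.
  move=> [[[] x] c] [[[] x'] c']; rewrite entry_compE entry_idmE.
  rewrite sum_lunit entry_lunit_inv /=.
  rewrite adm1l !xpair_eqE /= ?andbT (eq_sym x').
  case: (x =P x') => [<-|_]; last by rewrite !mulr0 !andbF.
  rewrite mulr1 -natr_andb (eq_sym c) (eq_sym c'); congr (nat_of_bool _)%:R.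
  by case: (live x) => //=; case: (lab x =P c) => [->|_].
move=> x x'; rewrite entry_compE entry_idmE sum_lunit_inv entry_lunit eqxx andbT.
by case: (live x); rewrite /= ?mul1r ?mul0r.
Qed.

Lemma runit_morK X : inverse_pair (runit_mor X) (runit_mor_inv X).
Proof.
split; apply: entryP.
  move=> [[x []] c] [[x' []] c']; rewrite entry_compE entry_idmE.
  rewrite sum_runit entry_runit_inv /=.
  rewrite adm1r !xpair_eqE /= ?andbT (eq_sym x').
  case: (x =P x') => [<-|_]; last by rewrite !mulr0 !andbF.
  rewrite mulr1 -natr_andb (eq_sym c) (eq_sym c'); congr (nat_of_bool _)%:R.
  by case: (live x) => //=; case: (lab x =P c) => [->|_].
move=> x x'; rewrite entry_compE entry_idmE sum_runit_inv entry_runit eqxx andbT.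
by case: (live x); rewrite /= ?mul1r ?mul0r.
Qed.

Lemma lunit_mor_natural X Y (f : hom C X Y) :
  lunit_mor Y \oc tens_mor (idm C unit_ob) f = f \oc lunit_mor X.
Proof.
apply: entryP => -[[[] x] c] y; rewrite !entry_compE sum_tensm sum_lunit sum_unit.
under eq_bigr => y' _ do rewrite entry_idmE entry_lunit mul1r mulrA.
rewrite sum_deltar /= adm1l eq_sym.
have [->|/entry_compat/and3P[-> -> /eqP->]] := eqVneq (entry f x y) 0.
  by ring.
by case: (c == _); rewrite ?mulr0 ?mul0r //= mulr1 !mul1r.
Qed.

Lemma runit_mor_natural X Y (f : hom C X Y) :
  runit_mor Y \oc tens_mor f (idm C unit_ob) = f \oc runit_mor X.
Proof.
apply: entryP => -[[x []] c] y; rewrite !entry_compE sum_tensm sum_runit.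
under eq_bigr => y' _ do rewrite sum_unit entry_idmE entry_runit mulr1 mulrA.
rewrite sum_deltar /= adm1r eq_sym.
have [->|/entry_compat/and3P[-> -> /eqP->]] := eqVneq (entry f x y) 0.
  by ring.
by case: (c == _); rewrite ?mulr0 ?mul0r //= mulr1 !mul1r.
Qed.

Lemma assoc_mor_triangle X Y :
  (tens_mor (idm C X) (lunit_mor Y) : hom C _ _) \oc assoc_mor X unit_ob Y =
  tens_mor (runit_mor X) (idm C Y).
Proof.
apply: entryP => -[[[[x []] e] y] d] [[x' y'] d'].
rewrite entry_compE sum_assoc.
rewrite (eq_bigr (fun f => (f == lab y)%:R *
   (F (lab x) (unit_label S) (lab y) d e f * ((N (lab x) f d && (d == d'))%:R *
     ((live x && (x == x'))%:R * (live y && (y == y'))%:R))))); last first.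
  by move=> f _; rewrite entry_tensm entry_idmE entry_lunit !natr_andb /=; ring.
under eq_bigr => f _ do rewrite mulrC.
rewrite sum_deltar entry_tensm entry_runit entry_idmE /=.
case: (e =P lab x) => [->|nex]; last first.
  have -> : F (lab x) (unit_label S) (lab y) d e (lab y) = 0.
    apply/eqP; apply: contraT => /sixF_adm/and4P[].
    by rewrite adm1r => /eqP/esym.
  by rewrite andbF !mul0r !mulr0.
case Nd: (N (lab x) (lab y) d); last by rewrite !mul0r !mulr0.
rewrite sixF_triangle // !natr_andb /=.
by case: (live x); case: (live y); rewrite /= ?mulr0n; ring.
Qed.

Definition monoidal_of_sixj : monoidalCategory k :=
  MonoidalCategory tens_mor1 tens_mor_comp tens_mor_linearl tens_mor_linearr
    assoc_morK lunit_morK runit_morK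
    assoc_mor_natural lunit_mor_natural runit_mor_natural
    assoc_mor_pentagon assoc_mor_triangle.

Lemma sum_tens1m X Y Y' (g : hom C Y Y') x y c K :
  \sum_q entry (tens_mor (idm C X) g) (x, y, c) q * K q =
  (live x && N (lab x) (lab y) c)%:R * \sum_y' entry g y y' * K (x, y', c).
Proof.
rewrite sum_tensm andbC natr_andb -mulrA; congr (_ * _).
rewrite -(sum_idl x (fun x' => \sum_y' entry g y y' * K (x', y', c))).
apply: eq_bigr => x' _; rewrite mulr_sumr.
by apply: eq_bigr => y' _; rewrite mulrA.
Qed.

(** The labels of the dual are given by an equation, rather than as a composite with
    [dual_label], so that, [dual_label] being involutive, the statement also
    exhibits X as a dual of its dual. The duality equations reduce to one 6j
    symbol each, at the unit channels; the factor [al] in [ev] cancels it. *)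
Lemma is_left_dual_pointwise (T : finType) (a b : T -> I) (P : pred T) :
    (forall x, b x = dual_label S (a x)) ->
  @is_left_dual k monoidal_of_sixj (LSet a P) (LSet b P).
Proof.
move=> bE; pose X : C := LSet a P; pose D : C := LSet b P.
have aE x : a x = dual_label S (b x) by rewrite bE dual_dual.
pose al (x : T) : k := (F (a x) (b x) (a x) (a x) (unit_label S) (unit_label S))^-1.
pose ev : hom C (tens_ob D X) unit_ob :=
  mor_of (fun (p : pt (tens_ob D X)) _ => (p.1.1 == p.1.2)%:R * al p.1.1).
pose coev : hom C unit_ob (tens_ob X D) :=
  mor_of (fun _ (p : pt (tens_ob X D)) => (p.1.1 == p.1.2)%:R).
have entry_ev d x c t : entry ev (d, x, c) t =
    (P x)%:R * ((d == x)%:R * (c == unit_label S)%:R * al x).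
  rewrite entry_mor_of /compat /=; case: (d =P x) => [->|_]; last first.
    by rewrite !mul0r mulr0 if_same.
  case: (c =P unit_label S) => [->|_]; last by rewrite andbF !(mul0r, mulr0).
  by rewrite aE adm_dual; case: (P x); rewrite /= ?mul1r ?mul0r ?mul1r.
have sum_coev t K : \sum_q entry coev t q * K q = \sum_y (P y)%:R * K (y, y, unit_label S).
  rewrite (sum_supp (h := fun y => (y, y, unit_label S))) => [|? ? [] //|].
    apply: eq_bigr => y _; congr (_ * _); rewrite entry_mor_of /compat /= !eqxx bE.
    by rewrite adm_dual; case: (P y).
  move=> [[y y'] c]; rewrite entry_mor_of /compat /=.
  case: (y =P y') => [<-|_]; last by rewrite if_same mul0r eqxx.
  case: (unit_label S =P c) => [<-|_]; first by exists y.
  by rewrite andbF mul0r eqxx.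
exists ev, coev; split.
- apply: entryP => x x'; rewrite entry_compE sum_lunit_inv entry_compE sum_tensm1 sum_coev.
  rewrite (eq_bigr (fun y => (y == x)%:R * ((P x)%:R * (x == x')%:R))).
    under eq_bigr => y _ do rewrite mulrC.
    rewrite sum_deltar entry_idmE /= adm1l eqxx andbT natr_andb.
    by case: (P x); rewrite /= ?mul0r ?mul1r.
  move=> y _; rewrite entry_compE sum_assoc.
  rewrite (eq_bigr (fun f => (f == unit_label S)%:R * (
    F (a y) (b y) (a x) (a x) (unit_label S) f * (N (a y) f (a x))%:R *
    (P y)%:R * (P x)%:R * (y == x)%:R * al x * (a x == a y)%:R * (y == x')%:R))).
    under eq_bigr => f _ do rewrite mulrC.
    rewrite sum_deltar /=; case: (y =P x) => [->|_]; last by rewrite !(mulr0, mul0r).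
    rewrite adm1r eqxx /al mulrC.
    have nz : F (a x) (b x) (a x) (a x) (unit_label S) (unit_label S) != 0.
      by rewrite bE sixF_dual_neq0.
    by case: (P x); rewrite /= ?mulr0n; field.
  move=> f _; rewrite entry_compE sum_tens1m sum_unit entry_ev entry_runit /= !natr_andb.
  by case: (P y); rewrite /= ?mulr0n; ring.
- apply: entryP => x x'; rewrite entry_compE sum_runit_inv entry_compE sum_tens1m sum_coev.
  rewrite (eq_bigr (fun y => (y == x)%:R * ((P x)%:R * (x == x')%:R))).
    under eq_bigr => y _ do rewrite mulrC.
    rewrite sum_deltar entry_idmE /= adm1r eqxx andbT natr_andb.
    by case: (P x); rewrite /= ?mul0r ?mul1r.
  move=> y _; rewrite entry_compE sum_assoc_inv.
  rewrite (eq_bigr (fun e => (e == unit_label S)%:R * (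
    F (b x) (a y) (b y) (b x) e (unit_label S) * (N e (b y) (b x))%:R *
    (P y)%:R * (P x)%:R * (y == x)%:R * al y * (b x == b y)%:R * (y == x')%:R))).
    under eq_bigr => f _ do rewrite mulrC.
    rewrite sum_deltar /=; case: (y =P x) => [->|_]; last by rewrite !(mulr0, mul0r).
    rewrite adm1l eqxx /al mulrC.
    have -> : F (b x) (a x) (b x) (b x) (unit_label S) (unit_label S) =
              F (a x) (b x) (a x) (a x) (unit_label S) (unit_label S) by rewrite !bE sixF_dual.
    have nz : F (a x) (b x) (a x) (a x) (unit_label S) (unit_label S) != 0.
      by rewrite bE sixF_dual_neq0.
    by case: (P x); rewrite /= ?mulr0n; field.
  move=> e _; rewrite entry_compE sum_tensm1 sum_unit entry_ev entry_lunit /= !natr_andb.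
  rewrite (eq_sym x); case: (y =P x) => [->|_]; last by rewrite !(mul0r, mulr0).
  by case: (P x); rewrite /= ?mulr0n; ring.
Qed.

Lemma rigid_of_sixj : rigid monoidal_of_sixj.
Proof.
case=> T a P; split; exists (LSet (fun x => dual_label S (a x)) P);
  apply: is_left_dual_pointwise => // x.
by rewrite dual_dual.
Qed.

(** * The fusion category of a system of 6j-symbols and its Grothendieck ring *)

Hypothesis char0 : [pchar k] =i pred0.

Lemma matcat_finite : exists r, @simple_representatives k C r.
Proof.
exists (existT (fun n => 'I_n -> C) #|I| (fun i => point k (enum_val i))).
split=> [i|i j /(point_inj char0)/enum_val_inj //|X /simple_point[l Xl]].
  exact: point_simple.
by exists (enum_rank l); rewrite /= enum_rankK.
Qed.

Definition fusion_of_sixj : fusionCategory k :=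
  @FusionCategory k monoidal_of_sixj (@matcat_semisimple k I) rigid_of_sixj matcat_finite
    (point_simple k (unit_label S)).

Lemma label_count_tens l a b :
  label_count l (tens_ob (point k a) (point k b)) = N a b l.
Proof.
rewrite /label_count; case Nabl: (N a b l).
  apply: (@eq_card1 _ (tt, tt, l)) => -[[[] []] c].
  rewrite !inE /= xpair_eqE /= andbC.
  by case: (c =P l) => [->|_] //.
by apply: eq_card0 => -[[[] []] c]; rewrite !inE /= andbC; case: (c =P l) => [->|_] //.
Qed.

(** A summand isomorphic to X counts 1 for the label l and any other simple summand
    counts 0, whichever decomposition was chosen. *)
Lemma multiplicity_label (Y X : fusion_of_sixj) l : isomorphic X (point k l) ->
  multiplicity Y X = label_count l Y.
Proof.
move=> Xl; rewrite /multiplicity; case: (svalP (cid (proj2 (fus_semisimple fusion_of_sixj) Y))).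
rewrite -/(decomposition Y); case: (decomposition Y) => m s /= sims sumY.
rewrite (label_count_sum char0 l sumY) -sum1_card big_mkcond; apply: eq_bigr => t _.
have [l' stl'] := simple_point (sims t).
rewrite (label_count_iso char0 l stl') label_count_point inE.
case: asboolP => [stX|nstX].
  suff -> : l' = l by rewrite eqxx.
  apply: (point_inj char0); apply: isomorphic_trans Xl.
  by apply: isomorphic_trans stX; apply: isomorphic_sym.
case: eqP => // l'l; case: nstX; apply: isomorphic_trans (isomorphic_sym Xl).
by rewrite -l'l.
Qed.

End Monoidal.

(** A chosen representative of a simple class is sent to its label. *)
Lemma sixj_categorification (k : fieldType) (R : basedData) (S : sixj k R) :
    [pchar k] =i pred0 -> unit_label S = bone R ->
    (forall i j l : R, sc i j l = adm S i j l) ->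
  exists B : fusionCategory k, fusion_ring_iso (K0 B) R.
Proof.
move=> char0 oneE scE; pose B := fusion_of_sixj S char0; exists B.
have simP := simplesP B; set r := simples B in simP.
have labP i : exists l : R, isomorphic (projT2 r i) (point k l).
  by case: simP => sims _ _; apply: simple_point.
pose f i := sval (cid (labP i)).
have fP i : isomorphic (projT2 r i) (point k (f i)) := svalP (cid (labP i)).
have injf : injective f.
  move=> i j fij; case: simP => _ inj _; apply: inj.
  by apply: isomorphic_trans (fP i) _; rewrite fij; apply: isomorphic_sym.
exists f; split.
- have surjf l : exists i, f i == l.
    case: simP => _ _ /(_ (point k l) (point_simple k l))[i li]; exists i.
    apply/eqP/(point_inj char0); apply: isomorphic_sym.
    exact: isomorphic_trans li (fP i).
  exists (fun l => xchoose (surjf l)) => [i|l]; last exact/eqP/(xchooseP (surjf l)).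
  by apply: injf; apply/eqP/(xchooseP (surjf (f i))).
- rewrite -oneE; apply: (point_inj char0); apply: isomorphic_sym.
  exact: isomorphic_trans (svalP (cid (unit_in_simples B))) (fP _).
move=> i j l; rewrite scE /= (multiplicity_label _ (fP l)).
rewrite (label_count_iso char0 _ (tens_isomorphic (fP i) (fP j))).
by rewrite label_count_tens.
Qed.

(** * The 6j-symbols of R'(0) *)

(** The pair (a, b) stands for a + b sqrt 2. *)
Definition zr2 : Type := int * int.
Definition zr2_add (a b : zr2) : zr2 := (a.1 + b.1, a.2 + b.2).
Definition zr2_mul (a b : zr2) : zr2 :=
  (a.1 * b.1 + (a.2 * b.2) *+ 2, a.1 * b.2 + a.2 * b.1).

Definition is_X (x : Rprime0_basis) : bool := if x is inr _ then true else false.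
Definition h_exp (x : Rprime0_basis) : bool := if x is inl (_, b) then b else false.

Definition in_mul (i j l : Rprime0_basis) : bool := l \in Rprime0_mul i j.

(** Twice the 6j-symbol. The image of g^a h^b in the Ising category is psi^b and that
    of X and X* is sigma, so only the exponent of h and the kind of the labels
    matter. With the bicharacter chi(a, b) = (-1)^(a b), the Ising symbols are
    chi(i, l) for (psi^i, sigma, psi^l), chi(j, d) for (sigma, psi^j, sigma) on the
    component psi^d, chi(e, f) / sqrt 2 for (sigma, sigma, sigma), and 1 for the
    other triples. The sign below covers all these cases: the exponent of h is 0
    on X and X*, and for four invertible labels the three products add up to an
    even number. *)
Definition ising6j_num (i j l d e f : Rprime0_basis) : zr2 :=
  if [&& in_mul i j e, in_mul e l d, in_mul j l f & in_mul i f d] then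
    let sg := (-1) ^+ (h_exp e && h_exp f (+) h_exp j && h_exp d
                       (+) h_exp i && h_exp l) in
    if [&& is_X i, is_X j & is_X l] then (0, sg) else (sg *+ 2, 0)
  else (0, 0).

Definition labels : seq Rprime0_basis :=
  [:: inl (false, false); inl (false, true); inl (true, false); inl (true, true);
      inr false; inr true].

Lemma mem_labels x : x \in labels.
Proof. by case: x => [[[] []]|[]]. Qed.

Definition zr2_sum (g : Rprime0_basis -> zr2) : zr2 :=
  foldr (fun x => zr2_add (g x)) (0, 0) labels.

(** Only the channels that occur are enumerated, so that the checks stay small; on
    the other tuples both sides of the identities vanish. *)
Definition pentagon_check : bool :=
  all (fun i => all (fun j => all (fun l => all (fun m =>
  all (fun e => all (fun f => all (fun u => all (fun g => all (fun h =>
    in_mul i h u ==>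
    (zr2_sum (fun x => zr2_mul (zr2_mul (ising6j_num i j l f e x) (ising6j_num i x m u f h))
                               (ising6j_num j l m h x g)) ==
     zr2_mul (2, 0) (zr2_mul (ising6j_num e l m u f g) (ising6j_num i j g u e h))))
    (Rprime0_mul j g)) (Rprime0_mul l m)) (Rprime0_mul f m))
    (Rprime0_mul e l)) (Rprime0_mul i j))
    labels) labels) labels) labels.

Lemma pentagon_checked : pentagon_check.
Proof. by vm_compute. Qed.

Definition row_check : bool :=
  all (fun i => all (fun j => all (fun l =>
  all (fun e => all (fun d => all (fun e' =>
    zr2_sum (fun f => zr2_mul (ising6j_num i j l d e f) (ising6j_num i j l d e' f)) ==
    ((e == e')%:R *+ 4, 0))
    (Rprime0_mul i j)) (Rprime0_mul e l)) (Rprime0_mul i j))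
    labels) labels) labels.

Lemma row_checked : row_check.
Proof. by vm_compute. Qed.

Definition col_check : bool :=
  all (fun i => all (fun j => all (fun l =>
  all (fun f => all (fun d => all (fun f' =>
    zr2_sum (fun e => zr2_mul (ising6j_num i j l d e f) (ising6j_num i j l d e f')) ==
    ((f == f')%:R *+ 4, 0))
    (Rprime0_mul j l)) (Rprime0_mul i f)) (Rprime0_mul j l))
    labels) labels) labels.

Lemma col_checked : col_check.
Proof. by vm_compute. Qed.

Definition triangle_check : bool :=
  all (fun i => all (fun j => all (fun d =>
    ising6j_num i (bone Rprime0) j d i j == (2, 0)) (Rprime0_mul i j)) labels) labels.
Lemma triangle_checked : triangle_check.
Proof. by vm_compute. Qed.

(** * Transport to a field containing a square root of 2 *)
Section RealizeSixJ.
Variables (k : fieldType) (s : k).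
Hypotheses (nz2 : 2 != 0 :> k) (s2 : s ^+ 2 = 2).

Definition zr2_eval (a : zr2) : k := a.1%:~R + a.2%:~R * s.

Lemma zr2_eval_add a b : zr2_eval (zr2_add a b) = zr2_eval a + zr2_eval b.
Proof. by rewrite /zr2_eval /= !rmorphD /=; ring. Qed.

Lemma zr2_eval_mul a b : zr2_eval (zr2_mul a b) = zr2_eval a * zr2_eval b.
Proof. by rewrite /zr2_eval /= !rmorphD !rmorphM /=; ring: s2. Qed.

Lemma zr2_eval_sum (g : Rprime0_basis -> zr2) :
  zr2_eval (zr2_sum g) = \sum_x zr2_eval (g x).
Proof.
have perm_labels : perm_eq (index_enum Rprime0_basis) labels.
  apply: uniq_perm => [||x]; [exact: index_enum_uniq | by [] |].
  by rewrite mem_index_enum mem_labels.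
rewrite (perm_big _ perm_labels) /= /zr2_sum.
elim: labels => [|x r IH] /=; first by rewrite big_nil /zr2_eval /=; ring.
by rewrite big_cons zr2_eval_add IH.
Qed.

Definition ising6j i j l d e f : k := zr2_eval (ising6j_num i j l d e f) / 2.

Lemma zr2_eval_int n : zr2_eval (n, 0) = n%:~R.
Proof. by rewrite /zr2_eval mul0r addr0. Qed.

Lemma ising6j_adm i j l d e f : ising6j i j l d e f != 0 ->
  [&& in_mul i j e, in_mul e l d, in_mul j l f & in_mul i f d].
Proof.
rewrite /ising6j /ising6j_num; case: ifP => // _.
by rewrite zr2_eval_int mul0r eqxx.
Qed.

Lemma ising6j_row i j l d e e' :
  \sum_f ising6j i j l d e f * ising6j i j l d e' f =
  [&& e == e', in_mul i j e & in_mul e l d]%:R.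
Proof.
have [/and3P[ije eld ije']|nadm] := boolP [&& in_mul i j e, in_mul e l d & in_mul i j e'].
  have := row_checked => /allP/(_ i (mem_labels i))/allP/(_ j (mem_labels j)).
  move=> /allP/(_ l (mem_labels l))/allP/(_ e ije)/allP/(_ d eld)/allP/(_ e' ije').
  move/eqP/(congr1 zr2_eval); rewrite zr2_eval_sum zr2_eval_int ije eld andbT.
  under eq_bigr => f _ do rewrite zr2_eval_mul.
  move=> sumE; apply: (mulIf (mulf_neq0 nz2 nz2)).
  rewrite mulr_suml (eq_bigr (fun f => zr2_eval (ising6j_num i j l d e f) *
    zr2_eval (ising6j_num i j l d e' f))); last first.
    by move=> f _; rewrite /ising6j; field.
  by rewrite sumE; case: (e == e'); rewrite ?andbT ?andbF /= ?mulr0n; ring.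
rewrite big1 => [|f _].
  case: (e =P e') nadm => [<-|_] //=; case: (in_mul i j e); case: (in_mul e l d) => //.
apply/eqP; rewrite mulf_eq0; apply: contraR nadm; rewrite negb_or.
by case/andP => /ising6j_adm/and4P[-> -> _ _] /ising6j_adm/and4P[-> _ _ _].
Qed.

Lemma ising6j_col i j l d f f' :
  \sum_e ising6j i j l d e f * ising6j i j l d e f' =
  [&& f == f', in_mul j l f & in_mul i f d]%:R.
Proof.
have [/and3P[jlf ifd jlf']|nadm] := boolP [&& in_mul j l f, in_mul i f d & in_mul j l f'].
  have := col_checked => /allP/(_ i (mem_labels i))/allP/(_ j (mem_labels j)).
  move=> /allP/(_ l (mem_labels l))/allP/(_ f jlf)/allP/(_ d ifd)/allP/(_ f' jlf').
  move/eqP/(congr1 zr2_eval); rewrite zr2_eval_sum zr2_eval_int jlf ifd andbT.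
  under eq_bigr => e _ do rewrite zr2_eval_mul.
  move=> sumE; apply: (mulIf (mulf_neq0 nz2 nz2)).
  rewrite mulr_suml (eq_bigr (fun e => zr2_eval (ising6j_num i j l d e f) *
    zr2_eval (ising6j_num i j l d e f'))); last first.
    by move=> e _; rewrite /ising6j; field.
  by rewrite sumE; case: (f == f'); rewrite ?andbT ?andbF /= ?mulr0n; ring.
rewrite big1 => [|e _].
  case: (f =P f') nadm => [<-|_] //=; case: (in_mul j l f); case: (in_mul i f d) => //.
apply/eqP; rewrite mulf_eq0; apply: contraR nadm; rewrite negb_or.
by case/andP => /ising6j_adm/and4P[_ _ -> ->] /ising6j_adm/and4P[_ _ -> _].
Qed.

Lemma ising6j_pentagon i j l m e f u g h :
  \sum_x ising6j i j l f e x * ising6j i x m u f h * ising6j j l m h x g =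
  ising6j e l m u f g * ising6j i j g u e h.
Proof.
(* Each of the six conditions occurs in a factor of either side. *)
have [adm6|nadm] := boolP [&& in_mul i j e, in_mul e l f, in_mul f m u,
    in_mul l m g, in_mul j g h & in_mul i h u].
  case/and5P: adm6 => ije elf fmu lmg /andP[jgh ihu].
  have := pentagon_checked => /allP/(_ i (mem_labels i))/allP/(_ j (mem_labels j)).
  move=> /allP/(_ l (mem_labels l))/allP/(_ m (mem_labels m)).
  move=> /allP/(_ e ije)/allP/(_ f elf)/allP/(_ u fmu)/allP/(_ g lmg)/allP/(_ h jgh).
  rewrite ihu implyTb => /eqP/(congr1 zr2_eval).
  rewrite zr2_eval_sum !zr2_eval_mul zr2_eval_int.
  under eq_bigr => x _ do rewrite !zr2_eval_mul.
  move=> sumE; apply: (mulIf (mulf_neq0 nz2 (mulf_neq0 nz2 nz2))).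
  rewrite mulr_suml (eq_bigr (fun x => zr2_eval (ising6j_num i j l f e x) *
    zr2_eval (ising6j_num i x m u f h) * zr2_eval (ising6j_num j l m h x g))); last first.
    by move=> x _; rewrite /ising6j; field.
  by rewrite sumE /ising6j; field.
rewrite big1 => [|x _]; apply/esym/eqP.
  rewrite mulf_eq0; apply: contraR nadm; rewrite negb_or.
  by case/andP => /ising6j_adm/and4P[-> -> -> _] /ising6j_adm/and4P[-> _ -> ->].
rewrite eq_sym 2!mulf_eq0; apply: contraR nadm; rewrite !negb_or -andbA.
case/and3P => /ising6j_adm/and4P[-> -> _ _] /ising6j_adm/and4P[_ -> _ ->].
by case/ising6j_adm/and4P => _ _ -> ->.
Qed.

Lemma ising6j_triangle i j d :
  in_mul i j d -> ising6j i (bone Rprime0) j d i j = 1.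
Proof.
move=> ijd; have := triangle_checked => /allP/(_ i (mem_labels i)).
move=> /allP/(_ j (mem_labels j))/allP/(_ d ijd)/eqP.
by rewrite /ising6j => ->; rewrite zr2_eval_int divff.
Qed.

Lemma ising6j_dual (i : Rprime0) :
  ising6j i (Rprime0_dual i) i i (bone Rprime0) (bone Rprime0) =
  ising6j (Rprime0_dual i) i (Rprime0_dual i) (Rprime0_dual i)
    (bone Rprime0) (bone Rprime0).
Proof. by congr (zr2_eval _ / _); case: i => [[[] []]|[]]. Qed.

Lemma ising6j_dual_neq0 (i : Rprime0) :
  ising6j i (Rprime0_dual i) i i (bone Rprime0) (bone Rprime0) != 0.
Proof.
have s0 : s != 0 by apply: contra_eq_neq s2 => ->; rewrite expr0n eq_sym.
rewrite mulf_neq0 ?invr_eq0 //; case: i => [[a b]|c].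
  have -> : ising6j_num (inl (a, b)) (inl (a, b)) (inl (a, b)) (inl (a, b))
     (bone Rprime0) (bone Rprime0) = (2, 0) by case: a b => [] [].
  by rewrite zr2_eval_int.
have -> : ising6j_num (inr c) (inr (~~ c)) (inr c) (inr c)
     (bone Rprime0) (bone Rprime0) = (0, 1) by case: c.
by rewrite /zr2_eval add0r mul1r.
Qed.

Definition Rprime0_sixj : sixj k Rprime0.
Proof.
refine (@SixJ k Rprime0 (bone Rprime0) Rprime0_dual in_mul ising6j _ _ _ _
  ising6j_adm ising6j_row ising6j_col ising6j_pentagon ising6j_triangle
  ising6j_dual ising6j_dual_neq0).
- by move=> [[[] []]|[]] [[[] []]|[]].
- by move=> [[[] []]|[]] [[[] []]|[]].
- by move=> [[[] []]|[]].
- by move=> [[[] []]|[]].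
Defined.

End RealizeSixJ.

Theorem lemma2 (k : closedFieldType) (char0 : [pchar k]%R =i pred0) :
  exists B : fusionCategory k, fusion_ring_iso (K0 B) Rprime0.
Proof.
have nz2 : 2 != 0 :> k by have /pcharf0P-> := char0.
have [s s2] : exists s : k, s ^+ 2 = 2.
  have [s sE] := @solve_monicpoly k 2 (fun i => if i == 0%N then 2 else 0) isT.
  exists s; rewrite sE big_ord_recl big_ord1 /=; ring.
apply: (@sixj_categorification _ _ (Rprime0_sixj nz2 s2)) => // i j l.
by move: i j l => [[[] []]|[]] [[[] []]|[]] [[[] []]|[]].
Qed.
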